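(* Consider a finite sequence $\{\mathbf{X}_j\}$ of independent, random, self-adjoint matrices with dimension $n$, all of which satisfy the subexponential moment growth condition $$\mathbb{E}(\mathbf{X}_j^m)\preceq\frac{m!}{2}B^{m-2}\boldsymbol{\Sigma}_j^2\quad\text{for }m=2,3,4,\ldots,$$ where $B$ is a positive constant and $\boldsymbol{\Sigma}_j^2$ are (fixed) positive-semidefinite matrices. Given an integer $1\le k\le n$, set $$\mu_k=\lambda_k\Big(\sum_j\mathbb{E}\,\mathbf{X}_j\Big).$$ Choose $\mathbf{V}_+\in\mathbb{V}^n_{n-k+1}$ that satisfies $$\mu_k=\lambda_{\max}\Big(\sum_j\mathbf{V}_+^*(\mathbb{E}\,\mathbf{X}_j)\mathbf{V}_+\Big),$$ and define $$\sigma_k^2=\lambda_{\max}\Big(\sum_j\mathbf{V}_+^*\boldsymbol{\Sigma}_j^2\mathbf{V}_+\Big).$$ Then, for any $t\ge0$, $$\mathbb{P}\Big\{\lambda_k\Big(\sum_j\mathbf{X}_j\Big)\ge\mu_k+t\Big\}\le(n-k+1)\cdot\exp\left\{-\frac{t^2/2}{\sigma_k^2+Bt}\right\}\tag{i}$$ $$\le\begin{cases}(n-k+1)\cdot\exp\left\{-\tfrac14\,t^2/\sigma_k^2\right\}&\text{for }t\le\sigma_k^2/B,\\(n-k+1)\cdot\exp\left\{-\tfrac14\,t/B\right\}&\text{for }t\ge\sigma_k^2/B.\end{cases}\tag{ii}$$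
   Context: Matrices are complex. For $1\le d\le n$, $\mathbb{V}^n_d=\{\mathbf{V}\in\mathbb{C}^{n\times d}:\mathbf{V}^*\mathbf{V}=\mathbf{I}\}$ is the complex Stiefel manifold. Eigenvalues of a self-adjoint matrix are listed in weakly decreasing order $\lambda_{\max}=\lambda_1\ge\lambda_2\ge\cdots$. $\mathbf{A}\preceq\mathbf{B}$ means that $\mathbf{B}-\mathbf{A}$ is positive semidefinite. In the degenerate case $t=\sigma_k^2=0$, quotients of the form $0/0$ are read as $0$. *)

(* Defs.v *)
From mathcomp Require Import all_boot all_order all_algebra.
From mathcomp Require Import complex.
From mathcomp Require Import all_classical all_reals all_analysis.

Set Implicit Arguments.
Unset Strict Implicit.
Unset Printing Implicit Defensive.

Import Order.TTheory GRing.Theory Num.Theory.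
Local Open Scope classical_set_scope.
Local Open Scope ring_scope.
Local Open Scope complex_scope.
Local Open Scope sesquilinear_scope.

Section Matrices.
Context {R : realType}.

Definition psdmx n (A : 'M[R[i]]_n) : Prop :=
  A \is hermsymmx /\ forall v : 'cV[R[i]]_n, 0 <= (v ^t* *m A *m v) 0 0.

Definition loewner_le n (A B : 'M[R[i]]_n) : Prop := psdmx (B - A).

Definition stiefel n d (V : 'M[R[i]]_(n, d)) : Prop := V ^t* *m V = 1%:M.

(* The roots of the characteristic polynomial, with multiplicity, in weakly
   decreasing order.  Taking real parts loses nothing for self-adjoint A,
   the only case in which this list is meaningful. *)
Definition eigvals n (A : 'M[R[i]]_n) : seq R :=
  sort >=%R
    [seq complex.Re z | z <- sval (closed_field_poly_normal (char_poly A))].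

(* Eigenvalues are numbered from 1: lambda 1 A is the largest one. *)
Definition lambda (k : nat) n (A : 'M[R[i]]_n) : R := (eigvals A)`_k.-1.

Definition lambda_max n (A : 'M[R[i]]_n) : R := lambda 1 A.

End Matrices.

Section RandomMatrices.
Context {d : measure_display} {T : measurableType d} {R : realType}.
Variable P : probability T R.

Definition random_mx n (X : T -> 'M[R[i]]_n) : Prop :=
  forall i j, measurable_fun [set: T] (fun w => complex.Re (X w i j)) /\
              measurable_fun [set: T] (fun w => complex.Im (X w i j)).

Definition integrable_mx n (X : T -> 'M[R[i]]_n) : Prop :=
  forall i j,
    P.-integrable [set: T] (fun w => (complex.Re (X w i j))%:E) /\
    P.-integrable [set: T] (fun w => (complex.Im (X w i j))%:E).

Definition expect_mx n (X : T -> 'M[R[i]]_n) : 'M[R[i]]_n :=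
  \matrix_(i, j) (fine 'E_P[fun w => complex.Re (X w i j)] +i*
                  fine 'E_P[fun w => complex.Im (X w i j)]).

(* The sigma-algebra on T generated by X, where matrices carry the Borel
   sigma-algebra of C^(n x n) = R^(2 n^2). *)
Definition sigma_mx n (X : T -> 'M[R[i]]_n) : set_system T :=
  <<s [set A | exists i j (B : set R), measurable B /\
        (A = [set w | B (complex.Re (X w i j))] \/
         A = [set w | B (complex.Im (X w i j))])] >>.

Definition independent_mx (I : finType) n (X : I -> T -> 'M[R[i]]_n) : Prop :=
  forall (J : {set I}) (A : I -> set T),
    (forall j, j \in J -> sigma_mx (X j) (A j)) ->
    P (\bigcap_(j in [set` J]) A j) = (\prod_(j in J) P (A j))%E.

(* Sigma2 stands for the matrix written as a square in the moment bound.
   Integrability of the powers is what makes their expectations exist; the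
   case m = 2 entails integrability of X itself when X is self-adjoint. *)
Definition subexp_moments n (B : R) (Sigma2 : 'M[R[i]]_n)
    (X : T -> 'M[R[i]]_n) : Prop :=
  forall m : nat, (2 <= m)%N ->
    integrable_mx (fun w => X w ^+ m) /\
    loewner_le (expect_mx (fun w => X w ^+ m))
               ((m`!%:R / 2 * B ^+ (m - 2))%:C *: Sigma2).

End RandomMatrices.

(* Main.v *)
From HB Require Import structures.
Require Import Defs.
From mathcomp Require Import all_boot all_order all_algebra.
From mathcomp Require Import complex ring lra zify.
From mathcomp Require Import all_classical all_reals all_analysis.
From mathcomp Require Import measurable_realfun.

(* Write [V'] for the adjoint of [V].  By Courant-Fischer a lower bound on
   [lambda_k Y] passes to the compression [V' Y V], so the Laplace transform
   bounds the probability by [exp (- th (mu + t))] times the mean of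
   [tr exp (th V' Y V)].  The summands are then replaced one at a time by the
   logarithm [L] of their matrix moment generating function [M = exp L].  This
   rests on the tangent form of Lieb's concavity theorem,
     [tr exp (Y + V' (X - L) V) <= tr (Dlog_M (V exp Y V') exp X)],
   whose right-hand side is linear in [exp X], so that independence and Fubini
   suffice to take expectations.  The tangent form is the Gibbs variational
   principle combined with a tangent to the relative entropy, itself written as
   an integral over [y] in [0, 1] of the jointly convex functions
   [<X, ((1 - y) L_A + y R_S)^-1 X>].
   The moment condition bounds [M] through Fatou's lemma applied to
   [(1 + th X / N)^N] with [N] even; finally [th = t / (sigma2 + B t)]. *)

Set Implicit Arguments.
Unset Strict Implicit.
Unset Printing Implicit Defensive.

Import Order.TTheory GRing.Theory Num.Theory.
Import numFieldNormedType.Exports.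
Local Open Scope classical_set_scope.
Local Open Scope ring_scope.
Local Open Scope complex_scope.
Local Open Scope sesquilinear_scope.

(** * Spectral calculus of self-adjoint matrices: traces, quadratic forms, functions of a matrix *)

Section SpectralCalculus.
Context {R : realType}.
Local Notation C := R[i].
Local Notation Re := complex.Re.
Local Notation Im := complex.Im.

(** The obstacle is that the summands do not commute, so the exponential of their sum does not
    factor. In the tangent form the coefficient [Dlog_M (V exp Y V')] depends on the other summands
    only and [exp X] on a single one. Replacing [exp X] by its mean [M] then loses nothing:
    [tr (Dlog_M Z M) = tr Z], and [V' V = I] reduces the right-hand side to [tr exp Y]. The
    logarithms left at the end are deterministic; [ln m <= m - 1] bounds each by [M - I], so only
    quadratic forms of [M] have to be estimated, and the trace of a matrix of size [n - k + 1]
    produces the factor in front. No exponential moment is assumed: integrability of [exp (th X)]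
    comes out of the Fatou bound, that of [exp Y] out of the induction over the summands. The
    relative entropy is homogeneous of degree one because [V' V = I], hence its tangents have no
    constant term. The integral over [y] is never formed: an explicit primitive with nonnegative
    derivative is compared at [0] and [1]. *)

Lemma adjmxM m n p (A : 'M[C]_(m, n)) (B : 'M[C]_(n, p)) :
  (A *m B)^t* = B^t* *m A^t*.
Proof. by rewrite trmx_mul map_mxM. Qed.

Lemma adjmxD m n (A B : 'M[C]_(m, n)) : (A + B)^t* = A^t* + B^t*.
Proof. by rewrite linearD map_mxD. Qed.

Lemma adjmxB m n (A B : 'M[C]_(m, n)) : (A - B)^t* = A^t* - B^t*.
Proof. by rewrite linearB map_mxB. Qed.

Lemma adjmx_sum m n I (r : seq I) (P : pred I) (F : I -> 'M[C]_(m, n)) :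
  (\sum_(i <- r | P i) F i)^t* = \sum_(i <- r | P i) (F i)^t*.
Proof. by rewrite linear_sum map_mx_sum. Qed.

Lemma adjmxE m n (A : 'M[C]_(m, n)) i j : (A^t*) i j = (A j i)^*%C.
Proof. by rewrite !mxE. Qed.

Lemma hermP n (A : 'M[C]_n) : reflect (A^t* = A) (A \is hermsymmx).
Proof.
apply: (iffP (is_hermitianmxP _ _ _)); rewrite expr0 scale1r; first by move<-.
by move=> ->.
Qed.

Lemma cReM (x y : C) : Re (x * y) = Re x * Re y - Im x * Im y.
Proof. by case: x y => [a b] [c d]. Qed.

Lemma cReMr (x : R) (y : C) : Re (x%:C * y) = x * Re y.
Proof. by rewrite cReM /= mul0r subr0. Qed.

Lemma cRe_sum I (r : seq I) (P : pred I) (F : I -> C) :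
  Re (\sum_(i <- r | P i) F i) = \sum_(i <- r | P i) Re (F i).
Proof. by rewrite (big_morph (@complex.Re R) (id1 := 0) (op1 := +%R)) //; case=> ? ? []. Qed.

Lemma cImMr (x : R) (y : C) : Im (x%:C * y) = x * Im y.
Proof. by case: y => ? ? /=; rewrite mul0r addr0. Qed.

Lemma cIm_sum I (r : seq I) (P : pred I) (F : I -> C) :
  Im (\sum_(i <- r | P i) F i) = \sum_(i <- r | P i) Im (F i).
Proof. by rewrite (big_morph (@complex.Im R) (id1 := 0) (op1 := +%R)) //; case=> ? ? []. Qed.

Lemma cReMJ (x y : C) : Re (x^*%C * y) = Re x * Re y + Im x * Im y.
Proof. by case: x y => [a b] [c d] /=; ring. Qed.

Lemma cReD (x y : C) : Re (x + y) = Re x + Re y.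
Proof. by case: x y => [? ?] []. Qed.

Lemma cReN (x : C) : Re (- x) = - Re x.
Proof. by case: x. Qed.

Lemma cReJ (x : C) : Re (x^*%C) = Re x.
Proof. by case: x. Qed.

(** Real-valued, so that traces can be compared in [R] and integrated. *)
Definition retr n (A : 'M[C]_n) : R := Re (\tr A).

Lemma retrD n (A B : 'M[C]_n) : retr (A + B) = retr A + retr B.
Proof. by rewrite /retr linearD /= cReD. Qed.

Lemma retrN n (A : 'M[C]_n) : retr (- A) = - retr A.
Proof. by rewrite /retr linearN /= cReN. Qed.

Lemma retrB n (A B : 'M[C]_n) : retr (A - B) = retr A - retr B.
Proof. by rewrite retrD retrN. Qed.

Lemma retrC m n (A : 'M[C]_(m, n)) (B : 'M[C]_(n, m)) :
  retr (A *m B) = retr (B *m A).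
Proof. by rewrite /retr mxtrace_mulC. Qed.

Lemma retr_dot m n (A B : 'M[C]_(m, n)) :
  retr (A^t* *m B) =
  \sum_i \sum_j (Re (A i j) * Re (B i j) + Im (A i j) * Im (B i j)).
Proof.
rewrite /retr /mxtrace cRe_sum exchange_big /=; apply: eq_bigr => j _.
rewrite !mxE cRe_sum; apply: eq_bigr => i _.
by rewrite adjmxE cReMJ.
Qed.

Definition rdiag n (a : 'I_n -> R) : 'M[C]_n := diag_mx (\row_i (a i)%:C).

Definition spec n (U : 'M[C]_n) (a : 'I_n -> R) : 'M[C]_n :=
  U^t* *m rdiag a *m U.

Definition umx n (U : 'M[C]_n) := U *m U^t* = 1%:M.

Lemma unitaryV n (U : 'M[C]_n) : umx U -> U^t* *m U = 1%:M.
Proof. exact: mulmx1C. Qed.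

Lemma unitary1 n : umx (1%:M : 'M[C]_n).
Proof. by rewrite /umx mul1mx trmx1 map_mx1. Qed.

Lemma unitary_adj n (U : 'M[C]_n) : umx U -> umx (U^t*).
Proof. by move=> hU; rewrite /umx trmxCK; exact: unitaryV. Qed.

Lemma unitaryM n (U W : 'M[C]_n) : umx U -> umx W -> umx (U *m W).
Proof.
by move=> hU hW; rewrite /umx adjmxM mulmxA -(mulmxA U) hW mulmx1.
Qed.

Lemma rdiagE n (a : 'I_n -> R) i j : rdiag a i j = (a i *+ (i == j))%:C.
Proof. by rewrite !mxE; case: eqP => [->|]; rewrite ?mulr1n ?mulr0n. Qed.

Lemma mul_rdiagE n p (a : 'I_n -> R) (W : 'M[C]_(n, p)) i j :
  (rdiag a *m W) i j = (a i)%:C * W i j.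
Proof. by rewrite mul_diag_mx !mxE. Qed.

Lemma mul_mx_rdiagE m n (a : 'I_n -> R) (W : 'M[C]_(m, n)) i j :
  (W *m rdiag a) i j = W i j * (a j)%:C.
Proof. by rewrite mul_mx_diag !mxE. Qed.

Lemma rdiagM n (a b : 'I_n -> R) : rdiag a *m rdiag b = rdiag (fun i => a i * b i).
Proof.
apply/matrixP => i j; rewrite mul_rdiagE !rdiagE -rmorphM /= mulrnAr.
by case: eqP => [->|].
Qed.

Lemma rdiag_cst n c : rdiag (fun=> c) = c%:C%:M :> 'M[C]_n.
Proof. by apply/matrixP => i j; rewrite rdiagE mxE; case: eqP. Qed.

Lemma specE n (U : 'M[C]_n) a i j :
  spec U a i j = \sum_l (a l)%:C * ((U l i)^*%C * U l j).
Proof.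
rewrite /spec -mulmxA !mxE; apply: eq_bigr => l _.
by rewrite mul_rdiagE adjmxE mulrCA.
Qed.

Lemma spec_herm n (U : 'M[C]_n) a : (spec U a)^t* = spec U a.
Proof.
apply/matrixP=> i j; rewrite adjmxE !specE rmorph_sum; apply: eq_bigr => l _.
by rewrite !rmorphM /= oppr0 conjcK [U l j * _]mulrC.
Qed.

Lemma spectral_eq n (A : 'M[C]_n) : A^t* = A ->
  A = spec (spectralmx A) (fun i => Re (spectral_diag A 0 i)).
Proof.
move=> /hermP hA.
have /orthomx_spectralP e := hermitian_normalmx hA.
have e2 := invmx_unitary (spectral_unitarymx A).
rewrite e2 in e; apply: (etrans e); rewrite /spec; congr (_ *m diag_mx _ *m _).
apply/rowP => i; rewrite mxE RRe_real //.
by have /mxOverP/(_ 0 i) := hermitian_spectral_diag_real hA.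
Qed.

Lemma spectral_umx n (A : 'M[C]_n) : umx (spectralmx A).
Proof. by apply/unitarymxP; exact: spectral_unitarymx. Qed.

Lemma herm_spec n (A : 'M[C]_n) : A^t* = A ->
  exists U a, umx U /\ A = spec U a.
Proof.
move=> hA; exists (spectralmx A), (fun i => Re (spectral_diag A 0 i)).
by split; [exact: spectral_umx|exact: spectral_eq].
Qed.

Lemma conj_spec n (U W : 'M[C]_n) a :
  W^t* *m spec U a *m W = spec (U *m W) a.
Proof. by rewrite /spec adjmxM !mulmxA. Qed.

Lemma unitary_spec n (U : 'M[C]_n) a : umx U ->
  U *m spec U a = rdiag a *m U.
Proof. by move=> hU; rewrite /spec !mulmxA hU mul1mx. Qed.

Lemma spec_unitary n (U : 'M[C]_n) a : umx U ->
  spec U a *m U^t* = U^t* *m rdiag a.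
Proof. by move=> hU; rewrite /spec -(mulmxA _ U) hU mulmx1. Qed.

Lemma specM n (U : 'M[C]_n) a b : umx U ->
  spec U a *m spec U b = spec U (fun i => a i * b i).
Proof.
move=> hU.
have -> : spec U a *m spec U b =
    U^t* *m rdiag a *m (U *m spec U b) by rewrite !mulmxA.
by rewrite unitary_spec // mulmxA -(mulmxA _ _ (rdiag b)) rdiagM.
Qed.

Lemma spec_cst n (U : 'M[C]_n) c : umx U -> spec U (fun=> c) = c%:C%:M.
Proof.
move=> hU; rewrite /spec rdiag_cst.
by rewrite -mulmxA mul_scalar_mx -scalemxAr (unitaryV hU) scalemx1.
Qed.

Lemma rdiagD n (a b : 'I_n -> R) :
  rdiag a + rdiag b = rdiag (fun i => a i + b i).
Proof. by apply/matrixP => i j; rewrite [LHS]mxE !rdiagE mulrnDl rmorphD. Qed.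

Lemma rdiagZ n c (a : 'I_n -> R) : c%:C *: rdiag a = rdiag (fun i => c * a i).
Proof. by apply/matrixP => i j; rewrite [LHS]mxE !rdiagE -rmorphM mulrnAr. Qed.

Lemma specD n (U : 'M[C]_n) a b :
  spec U a + spec U b = spec U (fun i => a i + b i).
Proof. by rewrite /spec -mulmxDl -mulmxDr rdiagD. Qed.

Lemma eq_spec n (U : 'M[C]_n) a b : a =1 b -> spec U a = spec U b.
Proof. by move=> /funext ->. Qed.

Lemma specZ n (U : 'M[C]_n) c a : c%:C *: spec U a = spec U (fun i => c * a i).
Proof. by rewrite /spec scalemxAl scalemxAr rdiagZ. Qed.

Lemma specX n (U : 'M[C]_n) a m : umx U ->
  spec U a ^+ m = spec U (fun i => a i ^+ m).
Proof.
move=> hU; elim: m => [|m IH].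
  by rewrite expr0 (@eq_spec _ U _ (fun=> 1)) ?spec_cst.
by rewrite exprS IH [LHS](specM a _ hU); apply: eq_spec => i; rewrite exprS.
Qed.

Lemma retr_spec n (U : 'M[C]_n) a : umx U -> retr (spec U a) = \sum_i a i.
Proof.
move=> hU; rewrite /spec -mulmxA retrC -mulmxA hU mulmx1 /retr /mxtrace cRe_sum.
by apply: eq_bigr => i _; rewrite rdiagE eqxx.
Qed.

Lemma retr_unitary_dot m n (U : 'M[C]_m) (W : 'M[C]_n) (A B : 'M[C]_(m, n)) :
  umx U -> umx W ->
  retr ((U *m A *m W^t*)^t* *m (U *m B *m W^t*)) = retr (A^t* *m B).
Proof.
move=> hU hW; rewrite !adjmxM trmxCK !mulmxA retrC !mulmxA (unitaryV hW) mul1mx.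
by rewrite -(mulmxA _ _ U) (unitaryV hU) mulmx1.
Qed.

Definition qform n (A : 'M[C]_n) (v : 'cV[C]_n) : R := Re ((v^t* *m A *m v) 0 0).

Definition sqnorm (z : C) : R := Re z ^+ 2 + Im z ^+ 2.

Lemma sqnorm_ge0 z : 0 <= sqnorm z.
Proof. by rewrite addr_ge0 ?sqr_ge0. Qed.

Lemma cReJM z : Re (z^*%C * z) = sqnorm z.
Proof. by rewrite cReMJ /sqnorm !expr2. Qed.

Lemma qform_spec n (U : 'M[C]_n) a v :
  qform (spec U a) v = \sum_i a i * sqnorm ((U *m v) i 0).
Proof.
rewrite /qform /spec !mulmxA -adjmxM -!mulmxA mxE cRe_sum; apply: eq_bigr => i _.
by rewrite mul_rdiagE adjmxE mulrCA cReMr cReJM.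
Qed.

Lemma qform1 n (U : 'M[C]_n) v : umx U ->
  qform 1%:M v = \sum_i sqnorm ((U *m v) i 0).
Proof.
move=> hU; rewrite -[1%:M](spec_cst 1 hU) qform_spec.
by apply: eq_bigr => i _; rewrite mul1r.
Qed.

Lemma qformD n (A B : 'M[C]_n) v : qform (A + B) v = qform A v + qform B v.
Proof. by rewrite /qform mulmxDr mulmxDl mxE cReD. Qed.

Lemma qformN n (A : 'M[C]_n) v : qform (- A) v = - qform A v.
Proof. by rewrite /qform mulmxN mulNmx mxE cReN. Qed.

Lemma qformB n (A B : 'M[C]_n) v : qform (A - B) v = qform A v - qform B v.
Proof. by rewrite qformD qformN. Qed.

Lemma qformZ n c (A : 'M[C]_n) v : qform (c%:C *: A) v = c * qform A v.
Proof. by rewrite /qform -scalemxAr -scalemxAl mxE cReMr. Qed.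

Lemma qform_sum n I (r : seq I) (P : pred I) (F : I -> 'M[C]_n) v :
  qform (\sum_(i <- r | P i) F i) v = \sum_(i <- r | P i) qform (F i) v.
Proof.
apply: (big_morph (fun A => qform A v)); first by move=> ? ?; exact: qformD.
by rewrite /qform mulmx0 mul0mx mxE.
Qed.

Lemma qform_conj n p (A : 'M[C]_n) (V : 'M[C]_(n, p)) v :
  qform (V^t* *m A *m V) v = qform A (V *m v).
Proof. by rewrite /qform adjmxM !mulmxA. Qed.

Lemma psdmx_qform n (A : 'M[C]_n) v : psdmx A -> 0 <= qform A v.
Proof. by move=> [_ /(_ v)]; rewrite lecE => /andP[]. Qed.

Lemma qform_eigen n (U : 'M[C]_n) a i : umx U ->
  qform (spec U a) (U^t* *m delta_mx i 0) = a i.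
Proof.
move=> hU; rewrite qform_spec mulmxA hU mul1mx (bigD1 i) //= big1 ?addr0.
  by rewrite !mxE eqxx /sqnorm /= expr0n expr1n addr0 mulr1.
by move=> j /negPf jNi; rewrite !mxE jNi /sqnorm /= expr0n addr0 mulr0.
Qed.

Lemma qform_eigen1 n (U : 'M[C]_n) i : umx U ->
  qform 1%:M (U^t* *m delta_mx i 0) = 1.
Proof. by move=> hU; rewrite -[1%:M](spec_cst 1 hU) qform_eigen. Qed.

Lemma sqnorm_gt0 z : (0 < sqnorm z) = (z != 0).
Proof.
case: z => x y; rewrite /sqnorm /= lt_neqAle addr_ge0 ?sqr_ge0 // andbT eq_sym.
by rewrite paddr_eq0 ?sqr_ge0 // !sqrf_eq0 eq_complex.
Qed.

Lemma qform1_gt0 n (v : 'cV[C]_n) : v != 0 -> 0 < qform 1%:M v.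
Proof.
move=> v0; rewrite (qform1 _ (unitary1 _)) lt_neqAle sumr_ge0 ?andbT; last first.
  by move=> *; exact: sqnorm_ge0.
apply: contra_neq v0 => /esym/eqP; rewrite psumr_eq0 => [/allP h|i _]; last first.
  exact: sqnorm_ge0.
apply/colP => i; have := h i (mem_index_enum _); rewrite mul1mx mxE /=.
move=> /eqP e; apply/eqP; apply: contraTT (lexx (0 : R)).
by rewrite -sqnorm_gt0 e ltxx.
Qed.

(** The decomposition is the one picked by [spectralmx]; [spec_fun] shows that the choice does not
    matter. *)
Definition mxf (f : R -> R) n (A : 'M[C]_n) : 'M[C]_n :=
  spec (spectralmx A) (fun i => f (Re (spectral_diag A 0 i))).

(** The product of [U] with the adjoint of [W] intertwines the two diagonal matrices, so its entry
    at [i], [j] vanishes unless [a i = b j]. It therefore also intertwines their images under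
    [f]. *)
Lemma spec_fun n (U W : 'M[C]_n) a b (f : R -> R) : umx U -> umx W ->
  spec U a = spec W b -> spec U (f \o a) = spec W (f \o b).
Proof.
move=> hU hW e.
have e1 : rdiag a *m (U *m W^t*) =
    (U *m W^t*) *m rdiag b.
  rewrite mulmxA -unitary_spec // e /spec !mulmxA -!mulmxA hW mulmx1.
  by rewrite !mulmxA.
suff e2 : rdiag (f \o a) *m (U *m W^t*) =
    (U *m W^t*) *m rdiag (f \o b).
  transitivity (U^t* *m (rdiag (f \o a) *m (U *m W^t*)) *m W).
    by rewrite /spec -!mulmxA (unitaryV hW) mulmx1.
  by rewrite e2 !mulmxA (unitaryV hU) mul1mx.
apply/matrixP => i j; have /matrixP/(_ i j) := e1.
rewrite !mul_rdiagE !mul_mx_rdiagE; have [->|z0] := eqVneq ((U *m W^t*) i j) 0.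
  by rewrite !mulr0 !mul0r.
by rewrite mulrC => /(mulfI z0)[] /= ->; rewrite mulrC.
Qed.

Lemma mxf_spec n (U : 'M[C]_n) a f : umx U ->
  mxf f (spec U a) = spec U (f \o a).
Proof.
move=> hU; rewrite /mxf.
apply: (spec_fun f (spectral_umx _) hU (a := fun i => Re _)).
by rewrite -spectral_eq // spec_herm.
Qed.

End SpectralCalculus.

(** * Scalar calculus: primitives in the interpolation parameter [y] *)

Section ScalarCalculus.
Context {R : realType}.
Implicit Types (m t y : R).

(** The sign is asked for only inside the interval: in the application it is obtained after
    multiplying by [1 - y], which vanishes at [1]. *)
Lemma ger0_derive_le01 (f df : R -> R) :
  (forall y, 0 <= y <= 1 -> is_derive y 1 f (df y)) ->
  (forall y, 0 < y < 1 -> 0 <= df y) -> f 0 <= f 1.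
Proof.
move=> fdf df0.
have fd y : 0 <= y <= 1 -> derivable f y 1 by move=> /fdf[].
apply: (@ger0_derive1_le_cc _ f 0 1); rewrite ?in_itv /= ?lexx ?ler01 //.
- by move=> y; rewrite in_itv /= => /andP[/ltW y0 /ltW y1]; apply: fd; rewrite y0.
- move=> y; rewrite in_itv /= => /[dup] /andP[/ltW y0 /ltW y1] y01.
  have [_ e] : is_derive y 1 f (df y) by apply: fdf; rewrite y0.
  by rewrite derive1E e df0.
- by apply: derivable_within_continuous => y; rewrite in_itv /= => ?; exact: fd.
Qed.

Lemma is_derive_sum_fun (I : finType) (h : I -> R -> R) (dh : I -> R) y :
  (forall i, is_derive y 1 (h i) (dh i)) ->
  is_derive y 1 (fun z => \sum_i h i z) (\sum_i dh i).
Proof.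
move=> hd; rewrite (_ : (fun _ => _) = \sum_i h i); last first.
  by apply/funext => z; rewrite fct_sumE.
by elim/big_ind2 : _ => // [|] *; [exact: is_derive_cst|exact: is_deriveD].
Qed.

Lemma is_derive_scale (c y df : R) (f : R -> R) :
  is_derive y 1 f df -> is_derive y 1 (fun z => c * f z) (c * df).
Proof. exact: is_deriveZ. Qed.

Lemma is_derive_congr (y a b : R) (f : R -> R) :
  is_derive y 1 f a -> a = b -> is_derive y 1 f b.
Proof. by move=> ? <-. Qed.

Lemma is_derive_addf (y a b : R) (f g : R -> R) :
  is_derive y 1 f a -> is_derive y 1 g b ->
  is_derive y 1 (fun z => f z + g z) (a + b).
Proof. exact: is_deriveD. Qed.

Lemma is_derive_mulf (y a b : R) (f g : R -> R) :
  is_derive y 1 f a -> is_derive y 1 g b ->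
  is_derive y 1 (fun z => f z * g z) (f y * b + g y * a).
Proof. exact: is_deriveM. Qed.

Definition lin m t y := (1 - y) * m + y * t.

Lemma lin_gt0 m t y : 0 < m -> 0 < t -> 0 <= y <= 1 -> 0 < lin m t y.
Proof.
move=> m0 t0 /andP[y0 y1]; have [->|y_neq] := eqVneq y 0.
  by rewrite /lin subr0 mul1r mul0r addr0.
rewrite ltr_wpDl ?mulr_ge0 ?subr_ge0 ?(ltW m0) // mulr_gt0 //.
by rewrite lt_neqAle eq_sym y_neq.
Qed.

Lemma is_derive_lin m t y : is_derive y 1 (lin m t) (t - m).
Proof.
rewrite (_ : lin m t = (fun z => m + (t - m) * z)); last first.
  by apply/funext => z; rewrite /lin; ring.
apply: (is_derive_congr (is_derive_addf (is_derive_cst m y 1)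
  (is_derive_scale (t - m) (is_derive_id y 1)))).
by rewrite add0r mulr1.
Qed.

Lemma is_derive_ln_lin m t y : 0 < m -> 0 < t -> 0 <= y <= 1 ->
  is_derive y 1 (fun z => ln (lin m t z)) ((t - m) / lin m t y).
Proof.
move=> m0 t0 y01; rewrite mulrC.
apply: (@is_derive1_comp _ (@ln R) (lin m t)).
  by apply: is_derive1_ln; exact: lin_gt0.
exact: is_derive_lin.
Qed.

(* [psi] and [phi] are primitives, in [y], of the coefficients that
   [relent_tangent] produces for the choice [W i j = t_j / lin m_i t_j y * V i j]. *)
Definition psi m t t' y :=
  if t == t' then ln (lin m t y) + (1 - y) * m / lin m t y
  else (t' * ln (lin m t y) - t * ln (lin m t' y)) / (t' - t).

(** With [w = t / lin m t y] and [w' = t' / lin m t' y] this is [(y w w' - 1) / (1 - y)], with the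
    division by [1 - y] carried out so that [y = 1] is allowed. *)
Lemma is_derive_psi m t t' y : 0 < m -> 0 < t -> 0 < t' -> 0 <= y <= 1 ->
  is_derive y 1 (psi m t t')
    ((y * t * t' - (1 - y) * m ^+ 2 - y * m * (t + t'))
       / (lin m t y * lin m t' y)).
Proof.
move=> m0 t0 t'0 y01; rewrite /psi.
have := lin_gt0 m0 t0 y01; have := lin_gt0 m0 t'0 y01.
have dl := is_derive_ln_lin m0 t0 y01; have dl' := is_derive_ln_lin m0 t'0 y01.
case: eqP => [<-|/eqP tt'] l'0 l0.
  have -> : (fun z => ln (lin m t z) + (1 - z) * m / lin m t z) =
      (fun z => ln (lin m t z) + lin m 0 z * (lin m t z)^-1).
    by apply/funext => z; rewrite [lin m 0 _]/lin mulr0 addr0.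
  apply: (is_derive_congr (is_derive_addf dl (is_derive_mulf (is_derive_lin m 0 y)
    (is_deriveV _ (is_derive_lin m t y))))); first by rewrite gt_eqF.
  rewrite /GRing.scale /=.
  by move: l0; rewrite /lin => l0; field; rewrite gt_eqF.
have d0 : t' - t != 0 by rewrite subr_eq0 eq_sym.
have -> : (fun z => (t' * ln (lin m t z) - t * ln (lin m t' z)) / (t' - t)) =
   (fun z => (t' / (t' - t)) * ln (lin m t z) +
             (- t / (t' - t)) * ln (lin m t' z)).
  by apply/funext => z; field.
apply: (is_derive_congr (is_derive_addf (is_derive_scale _ dl)
  (is_derive_scale _ dl'))).
by move: l0 l'0; rewrite /lin => l0 l'0; field; rewrite d0 !gt_eqF.
Qed.

Definition phi m m' t y :=
  if m == m' then - ((1 - y) * t / lin m t y)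
  else t * (ln (lin m t y) - ln (lin m' t y)) / (m' - m).

Lemma is_derive_phi m m' t y : 0 < m -> 0 < m' -> 0 < t -> 0 <= y <= 1 ->
  is_derive y 1 (phi m m' t) (t ^+ 2 / (lin m t y * lin m' t y)).
Proof.
move=> m0 m'0 t0 y01; rewrite /phi.
have := lin_gt0 m0 t0 y01; have := lin_gt0 m'0 t0 y01.
have dl := is_derive_ln_lin m0 t0 y01; have dl' := is_derive_ln_lin m'0 t0 y01.
case: eqP => [<-|/eqP mm'] l'0 l0.
  have -> : (fun z => - ((1 - z) * t / lin m t z)) =
      (fun z => lin (- t) 0 z * (lin m t z)^-1).
    by apply/funext => z; rewrite [lin _ 0 _]/lin mulr0 addr0 mulrN mulNr.
  apply: (is_derive_congr (is_derive_mulf (is_derive_lin (- t) 0 y)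
    (is_deriveV _ (is_derive_lin m t y)))); first by rewrite gt_eqF.
  rewrite /GRing.scale /=.
  by move: l0; rewrite /lin => l0; field; rewrite gt_eqF.
have d0 : m' - m != 0 by rewrite subr_eq0 eq_sym.
have -> : (fun z => t * (ln (lin m t z) - ln (lin m' t z)) / (m' - m)) =
   (fun z => (t / (m' - m)) * ln (lin m t z) +
             (- t / (m' - m)) * ln (lin m' t z)).
  by apply/funext => z; field.
apply: (is_derive_congr (is_derive_addf (is_derive_scale _ dl)
  (is_derive_scale _ dl'))).
by move: l0 l'0; rewrite /lin => l0 l'0; field; rewrite d0 !gt_eqF.
Qed.

(** First divided difference of [ln], completed by the derivative on the diagonal. *)
Definition lndd m m' : R := if m == m' then m^-1 else (ln m - ln m') / (m - m').

Lemma lin0 m t : lin m t 0 = m. Proof. by rewrite /lin; ring. Qed.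
Lemma lin1 m t : lin m t 1 = t. Proof. by rewrite /lin; ring. Qed.

Lemma phi0 m m' t : phi m m' t 0 = - (t * lndd m m').
Proof.
rewrite /phi /lndd !lin0 subr0 mul1r; case: eqP => // _.
by rewrite -(opprB m m') invrN; ring.
Qed.

Lemma phi1 m m' t : phi m m' t 1 = 0.
Proof. by rewrite /phi !lin1 subrr !mul0r oppr0 subrr mulr0 mul0r if_same. Qed.

Lemma psi0 m t t' : 0 < m -> psi m t t' 0 = ln m + (t == t')%:R.
Proof.
move=> m0; rewrite /psi !lin0; case: eqP => [_|/eqP tt'].
  by rewrite subr0 mul1r divff // gt_eqF.
by rewrite addr0; field; rewrite subr_eq0 eq_sym.
Qed.

Lemma psi1_diag m t : psi m t t 1 = ln t.
Proof. by rewrite /psi eqxx !lin1 subrr !mul0r addr0. Qed.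

(** Independence of [m] at the endpoint is what lets orthonormality of the columns of [V] remove the
    off-diagonal terms of [G 1] in [relent_diag]. *)
Lemma psi1 m m' t t' : psi m t t' 1 = psi m' t t' 1.
Proof. by rewrite /psi !lin1 subrr !mul0r. Qed.

End ScalarCalculus.

(** * The tangent inequality for the relative entropy *)

Section RelativeEntropy.
Context {R : realType}.
Local Notation C := R[i].
Local Notation Re := complex.Re.
Local Notation Im := complex.Im.

Definition rdot (x y : C) : R := Re x * Re y + Im x * Im y.

Lemma rdotZ (c d : R) x y : rdot (c%:C * x) (d%:C * y) = c * d * rdot x y.
Proof. by case: x y => [a b] [e f]; rewrite /rdot /=; ring. Qed.

Lemma rdotxx x : rdot x x = sqnorm x.
Proof. by rewrite /rdot /sqnorm !expr2. Qed.

(** Left multiplication by [spec Ua a] and right multiplication by [spec Us s] commute; in their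
    joint eigenbasis they scale the entry at [p], [q] by [a p] and [s q]. *)
Lemma retr_spec2 n d (Ua : 'M[C]_n) a (Us : 'M[C]_d) s (P Q : 'M[C]_(n, d)) :
  umx Ua -> umx Us ->
  retr (P^t* *m spec Ua a *m Q *m spec Us s) =
  \sum_p \sum_q a p * s q *
    rdot ((Ua *m P *m Us^t*) p q) ((Ua *m Q *m Us^t*) p q).
Proof.
move=> hUa hUs.
have e : Ua *m (spec Ua a *m Q *m spec Us s) *m Us^t* =
    rdiag a *m (Ua *m Q *m Us^t*) *m rdiag s.
  have <- : (Ua *m spec Ua a) *m Q *m (spec Us s *m Us^t*) =
      Ua *m (spec Ua a *m Q *m spec Us s) *m Us^t* by rewrite !mulmxA.
  by rewrite unitary_spec // spec_unitary // !mulmxA.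
have -> : P^t* *m spec Ua a *m Q *m spec Us s =
    P^t* *m (spec Ua a *m Q *m spec Us s) by rewrite !mulmxA.
rewrite -(retr_unitary_dot _ _ hUa hUs) e.
rewrite retr_dot; apply: eq_bigr => p _; apply: eq_bigr => q _.
rewrite mul_mx_rdiagE mul_rdiagE -/(rdot _ _) -[X in rdot X _]mul1r.
by rewrite [_ * (s q)%:C]mulrC mulrA -rmorphM rdotZ mul1r [s q * _]mulrC.
Qed.

Lemma retr_unit2 n d (Ua : 'M[C]_n) (Us : 'M[C]_d) s (P Q : 'M[C]_(n, d)) :
  umx Ua -> umx Us ->
  retr (P^t* *m Q *m spec Us s) =
  \sum_p \sum_q s q *
    rdot ((Ua *m P *m Us^t*) p q) ((Ua *m Q *m Us^t*) p q).
Proof.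
move=> hUa hUs; have := retr_spec2 (fun=> 1) s P Q hUa hUs.
rewrite spec_cst // mulmx1 => ->.
by apply: eq_bigr => p _; apply: eq_bigr => q _; rewrite mul1r.
Qed.

(* For fixed [V] and [S], [W] ranges over tangents to the jointly convex
   [(K, X) |-> <X, K^-1 X>] with [K = (1 - y) L_A + y R_S], [X = V S]. *)
Lemma relent_tangent n d (Ua : 'M[C]_n) (a : 'I_n -> R) (Us : 'M[C]_d)
    (s : 'I_d -> R) (V W : 'M[C]_(n, d)) (y : R) : umx Ua -> umx Us ->
  (forall p, 0 < a p) -> (forall q, 0 < s q) -> 0 <= y <= 1 ->
  2 * retr (W^t* *m V *m spec Us s) <=
  \sum_p \sum_q sqnorm ((Ua *m V *m Us^t*) p q) * s q ^+ 2 / lin (a p) (s q) y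
  + (1 - y) * retr (W^t* *m spec Ua a *m W)
  + y * retr (W^t* *m W *m spec Us s).
Proof.
move=> hUa hUs a0 s0 y01.
have := retr_spec2 a (fun=> 1) W W hUa hUs; rewrite spec_cst // mulmx1.
move: (retr_unit2 s W V hUa hUs) (retr_unit2 s W W hUa hUs).
generalize (retr (W^t* *m V *m spec Us s)) (retr (W^t* *m W *m spec Us s)).
generalize (retr (W^t* *m spec Ua a *m W)) => ? ? ? -> -> ->.
rewrite !mulr_sumr -!big_split /=.
apply: ler_sum => p _; rewrite !mulr_sumr -!big_split /=; apply: ler_sum => q _.
have := lin_gt0 (a0 p) (s0 q) y01; set D := lin _ _ _ => D0.
set w := (Ua *m W *m Us^t*) p q; set b := (Ua *m V *m Us^t*) p q.
rewrite -subr_ge0 rdotxx /sqnorm /rdot.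
have -> : (Re b ^+ 2 + Im b ^+ 2) * s q ^+ 2 / D
   + (1 - y) * (a p * 1 * (Re w ^+ 2 + Im w ^+ 2)) + y * (s q * (Re w ^+ 2 + Im w ^+ 2))
   - 2 * (s q * (Re w * Re b + Im w * Im b))
  = ((s q * Re b - D * Re w) ^+ 2 + (s q * Im b - D * Im w) ^+ 2) / D.
  by have := D0; rewrite /D /lin => D0'; field; rewrite gt_eqF.
by apply: divr_ge0; [rewrite addr_ge0 ?sqr_ge0|exact: ltW].
Qed.

Definition had n d (V : 'M[C]_(n, d)) (x : 'I_n -> 'I_d -> R) : 'M[C]_(n, d) :=
  \matrix_(i, j) ((x i j)%:C * V i j).

Section Weights.
Variables (n d : nat) (V : 'M[C]_(n, d)) (A : 'M[C]_n) (S : 'M[C]_d).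

(** [beta] and [alpha] are the summands of [tr (V' V S)] and [tr (V' A V)]; real weights on the
    entries of [V] become scalar coefficients in front of them. *)
Definition beta i j j' : R := Re ((V i j)^*%C * (V i j' * S j' j)).
Definition alpha i i' j : R := Re ((V i j)^*%C * (A i i' * V i' j)).

Lemma had1 : had V (fun _ _ => 1) = V.
Proof. by apply/matrixP => i j; rewrite !mxE mul1r. Qed.

Lemma retr_beta x y : retr ((had V x)^t* *m had V y *m S) =
  \sum_i \sum_j \sum_j' x i j * y i j' * beta i j j'.
Proof.
rewrite -mulmxA retr_dot; apply: eq_bigr => i _; apply: eq_bigr => j _.
rewrite -cReMJ !mxE mulr_sumr cRe_sum; apply: eq_bigr => j' _.
rewrite mxE /beta; case: (V i j) (V i j') (S j' j) => [? ?] [? ?] [? ?] /=.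
by ring.
Qed.

Lemma retr_alpha x y : retr ((had V x)^t* *m A *m had V y) =
  \sum_i \sum_i' \sum_j x i j * y i' j * alpha i i' j.
Proof.
rewrite -mulmxA retr_dot; apply: eq_bigr => i _.
rewrite exchange_big /=; apply: eq_bigr => j _.
rewrite -cReMJ !mxE mulr_sumr cRe_sum; apply: eq_bigr => i' _.
rewrite mxE /alpha; case: (V i j) (V i' j) (A i i') => [? ?] [? ?] [? ?] /=.
by ring.
Qed.

Hypothesis hV : V^t* *m V = 1%:M.
Hypothesis hS : S^t* = S.

Lemma beta_sym i j j' : beta i j' j = beta i j j'.
Proof.
rewrite /beta -[LHS]cReJ !rmorphM /= conjcK; have <- : S j' j = (S j j')^*%C.
  by rewrite -adjmxE hS.
by rewrite mulrCA.
Qed.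

(** Summed over [i], [beta] contains the inner product of columns [j] and [j'] of [V], which
    vanishes unless [j = j']. *)
Lemma sum_beta_diag f :
  \sum_i \sum_j \sum_j' f j j' * beta i j j' = \sum_j f j j * Re (S j j).
Proof.
rewrite exchange_big; apply: eq_bigr => j _.
rewrite exchange_big (bigD1 j) //= [X in _ + X]big1 ?addr0 => [|j' j'j].
  rewrite -mulr_sumr -cRe_sum; congr (_ * Re _).
  have /matrixP/(_ j j) := hV; rewrite !mxE eqxx => e.
  under eq_bigr do rewrite mulrA.
  rewrite -mulr_suml (_ : \sum_i _ = 1) ?mul1r // -[RHS]e.
  by apply: eq_bigr => i _; rewrite adjmxE.
rewrite -mulr_sumr -cRe_sum; under eq_bigr do rewrite mulrA.
rewrite -mulr_suml (_ : \sum_i _ = 0) ?mul0r ?mulr0 //.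
have /matrixP/(_ j j') := hV; rewrite !mxE eq_sym (negPf j'j) => e; rewrite -[RHS]e.
by apply: eq_bigr => i _; rewrite adjmxE.
Qed.

End Weights.

(** The function [tr (S ln S) - tr (V' ln A V S)] is jointly convex in [S] and [A], with
    [A = spec Ua a]; the lemma places it above its tangent at [S = rdiag t], [A = rdiag m]. The gap
    is [G 1 - G 0], and [dG] is nonnegative by [relent_tangent] at each [y]. The triple sum is the
    derivative in the direction [A], with the logarithm differentiated at [rdiag m]. *)
Lemma relent_diag n d (V : 'M[C]_(n, d)) (m : 'I_n -> R) (t : 'I_d -> R)
    (Ua : 'M[C]_n) (a : 'I_n -> R) (Us : 'M[C]_d) (s : 'I_d -> R)
    (S := spec Us s) :
  V^t* *m V = 1%:M -> umx Ua -> umx Us ->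
  (forall i, 0 < m i) -> (forall j, 0 < t j) ->
  (forall p, 0 < a p) -> (forall q, 0 < s q) ->
  retr S + retr (V^t* *m spec Ua (@ln R \o a) *m V *m S)
    + retr (rdiag (@ln R \o t) *m S) <=
  retr (spec Us (fun q => s q * ln (s q)))
    + retr (V^t* *m rdiag (@ln R \o m) *m V *m S)
    + \sum_i \sum_i' \sum_j
        t j * lndd (m i) (m i') * alpha V (spec Ua a) i i' j.
Proof.
move=> hV hUa hUs m0 t0 a0 s0.
have hS : S^t* = S by exact: spec_herm.
set be := beta V S; set al := alpha V (spec Ua a).
pose sb p q := sqnorm ((Ua *m V *m Us^t*) p q).
pose G (y : R) := \sum_p \sum_q sb p q * s q * ln (lin (a p) (s q) y) +
  (\sum_i \sum_j \sum_j' be i j j' * (psi (m i) (t j) (t j') y -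
     ln (lin (m i) (t j) y) - ln (lin (m i) (t j') y)) +
   \sum_i \sum_i' \sum_j al i i' j * phi (m i) (m i') (t j) y).
(* At the point of tangency both multiplications are diagonal, and the optimal [W = K^-1 X] with
   [X = V *m rdiag t] is [V] with these entrywise weights. *)
pose wt (y : R) i j := t j / lin (m i) (t j) y.
pose dG (y : R) := \sum_p \sum_q sb p q * s q * ((s q - a p) / lin (a p) (s q) y) +
  (\sum_i \sum_j \sum_j' be i j j' *
     ((y * t j * t j' - (1 - y) * m i ^+ 2 - y * m i * (t j + t j'))
        / (lin (m i) (t j) y * lin (m i) (t j') y) -
      (t j - m i) / lin (m i) (t j) y - (t j' - m i) / lin (m i) (t j') y) +
   \sum_i \sum_i' \sum_j al i i' j *
     (t j ^+ 2 / (lin (m i) (t j) y * lin (m i') (t j) y))).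
have GdG (y : R) : 0 <= y <= 1 -> is_derive y 1 G (dG y).
  move=> y01; apply: is_derive_addf; last apply: is_derive_addf.
  - apply: is_derive_sum_fun => p; apply: is_derive_sum_fun => q.
    by apply: is_derive_scale; exact: is_derive_ln_lin.
  - apply: is_derive_sum_fun => i; apply: is_derive_sum_fun => j.
    apply: is_derive_sum_fun => j'; apply: is_derive_scale.
    apply: is_deriveB; first apply: is_deriveB; first exact: is_derive_psi.
      exact: is_derive_ln_lin.
    exact: is_derive_ln_lin.
  - apply: is_derive_sum_fun => i; apply: is_derive_sum_fun => i'.
    apply: is_derive_sum_fun => j; apply: is_derive_scale.
    exact: is_derive_phi.
have sumbe : \sum_i \sum_j \sum_j' be i j j' = \sum_p \sum_q sb p q * s q.
  have := retr_beta V S (fun _ _ => 1) (fun _ _ => 1).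
  rewrite had1 (retr_unit2 _ _ _ hUa hUs) => e.
  transitivity (\sum_i \sum_j \sum_j' 1 * 1 * be i j j').
    do 3 (apply: eq_bigr => ? _); by rewrite !mul1r.
  rewrite -e; do 2 (apply: eq_bigr => ? _); by rewrite rdotxx mulrC.
have dG_ge0 (y : R) : 0 < y < 1 -> 0 <= dG y.
  move=> /andP[y0 y1]; have y01 : 0 <= y <= 1 by rewrite !ltW.
  have y1' : 1 - y != 0 by rewrite subr_eq0 eq_sym lt_eqF.
  have := relent_tangent V (had V (wt y)) hUa hUs a0 s0 y01.
  have -> : retr ((had V (wt y))^t* *m V *m spec Us s) =
      \sum_i \sum_j \sum_j' wt y i j * be i j j'.
    rewrite -[X in _ *m X *m _](had1 V) retr_beta.
    by do 3 (apply: eq_bigr => ? _); rewrite mulr1.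
  rewrite retr_beta retr_alpha => tan.
  have {}tan : 2 * \sum_i \sum_j \sum_j' wt y i j * be i j j' <=
    \sum_p \sum_q sb p q * s q ^+ 2 / lin (a p) (s q) y +
    (1 - y) * (\sum_i \sum_i' \sum_j wt y i j * wt y i' j * al i i' j) +
    y * (\sum_i \sum_j \sum_j' wt y i j * wt y i j' * be i j j') by exact: tan.
  have D0 p q : lin (a p) (s q) y != 0 by rewrite gt_eqF ?lin_gt0.
  have E0 i j : lin (m i) (t j) y != 0 by rewrite gt_eqF ?lin_gt0.
  (* Symmetry of [beta] merges the two terms linear in the weights into the factor [2] of
     [relent_tangent]. *)
  have swap : \sum_i \sum_j \sum_j' wt y i j' * be i j j' =
      \sum_i \sum_j \sum_j' wt y i j * be i j j'.
    apply: eq_bigr => i _; rewrite exchange_big.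
    by do 2 (apply: eq_bigr => ? _); rewrite /be beta_sym.
  (* The factor [(1 - y)^-1], here and in [P2], comes from [t - lin m t y = (1 - y) * (t - m)]. *)
  have P1 : \sum_p \sum_q sb p q * s q * ((s q - a p) / lin (a p) (s q) y) =
     (1 - y)^-1 * (\sum_p \sum_q sb p q * s q ^+ 2 / lin (a p) (s q) y -
                   \sum_p \sum_q sb p q * s q).
    rewrite -sumrB mulr_sumr; apply: eq_bigr => p _.
    rewrite -sumrB mulr_sumr; apply: eq_bigr => q _.
    by have := D0 p q; rewrite /lin => D0'; field; rewrite D0' y1'.
  have P2 : \sum_i \sum_j \sum_j' be i j j' *
     ((y * t j * t j' - (1 - y) * m i ^+ 2 - y * m i * (t j + t j'))
        / (lin (m i) (t j) y * lin (m i) (t j') y) -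
      (t j - m i) / lin (m i) (t j) y - (t j' - m i) / lin (m i) (t j') y) =
     (1 - y)^-1 *
      (y * (\sum_i \sum_j \sum_j' wt y i j * wt y i j' * be i j j')
       + \sum_i \sum_j \sum_j' be i j j'
       - \sum_i \sum_j \sum_j' wt y i j * be i j j'
       - \sum_i \sum_j \sum_j' wt y i j' * be i j j').
    rewrite mulr_sumr -big_split -!sumrB mulr_sumr; apply: eq_bigr => i _.
    rewrite mulr_sumr -big_split -!sumrB mulr_sumr; apply: eq_bigr => j _.
    rewrite mulr_sumr -big_split -!sumrB mulr_sumr; apply: eq_bigr => j' _.
    have := E0 i j; have := E0 i j'; rewrite /wt /lin /= => E0' E0''.
    by field; rewrite E0' E0'' y1'.
  have P3 : \sum_i \sum_i' \sum_j al i i' j *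
     (t j ^+ 2 / (lin (m i) (t j) y * lin (m i') (t j) y)) =
     \sum_i \sum_i' \sum_j wt y i j * wt y i' j * al i i' j.
    do 3 (apply: eq_bigr => ? _); rewrite /wt.
    by field; rewrite !E0.
  rewrite /dG P1 P2 P3 swap sumbe.
  rewrite -(pmulr_rge0 _ (_ : 0 < 1 - y)) ?subr_gt0 //.
  rewrite !mulrDr !mulrA !divff // !mul1r; move: tan; lra.
have sum_beta_ij f : \sum_i \sum_j \sum_j' be i j j' * f j j' =
    \sum_j f j j * complex.Re (S j j).
  rewrite -(sum_beta_diag _ hV).
  by do 3 (apply: eq_bigr => ? _); rewrite mulrC.
have trS : retr S = \sum_j 1 * complex.Re (S j j).
  by rewrite /retr /mxtrace cRe_sum; apply: eq_bigr => j _; rewrite mul1r.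
have trlnt : retr (rdiag (@ln R \o t) *m S) = \sum_j ln (t j) * complex.Re (S j j).
  rewrite /retr /mxtrace cRe_sum; apply: eq_bigr => j _.
  by rewrite mul_rdiagE cReMr.
have trlnm : retr (V^t* *m rdiag (@ln R \o m) *m V *m S) =
    \sum_i \sum_j \sum_j' be i j j' * ln (m i).
  have -> : V^t* *m rdiag (@ln R \o m) *m V *m S =
     (had V (fun _ _ => 1))^t* *m (had V (fun i _ => ln (m i))) *m S.
    rewrite had1 -(mulmxA (V^t*)); congr (_ *m _ *m _).
    by apply/matrixP => i j; rewrite mul_rdiagE mxE.
  by rewrite retr_beta; do 3 (apply: eq_bigr => ? _); rewrite mul1r mulrC.
have trlna : retr (V^t* *m spec Ua (@ln R \o a) *m V *m S) =
    \sum_p \sum_q sb p q * s q * ln (a p).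
  rewrite (retr_spec2 _ _ _ _ hUa hUs); do 2 (apply: eq_bigr => ? _).
  by rewrite rdotxx /sb /=; ring.
have trlns : retr (spec Us (fun q => s q * ln (s q))) =
    \sum_p \sum_q sb p q * s q * ln (s q).
  rewrite -[spec Us _]mul1mx -hV (retr_unit2 _ _ _ hUa hUs).
  by do 2 (apply: eq_bigr => ? _); rewrite rdotxx /sb; ring.
have G0 : G 0 = \sum_p \sum_q sb p q * s q * ln (a p)
   + (retr S - \sum_i \sum_j \sum_j' be i j j' * ln (m i)
     - \sum_i \sum_i' \sum_j t j * lndd (m i) (m i') * al i i' j).
  rewrite /G; congr (_ + (_ + _)).
  - by do 2 (apply: eq_bigr => ? _); rewrite lin0.
  - have -> : retr S = \sum_i \sum_j \sum_j' be i j j' * (t j == t j')%:R.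
      by rewrite sum_beta_ij trS; apply: eq_bigr => j _; rewrite eqxx.
    rewrite -sumrB; apply: eq_bigr => i _; rewrite -sumrB; apply: eq_bigr => j _.
    rewrite -sumrB; apply: eq_bigr => j' _; rewrite psi0 // !lin0; ring.
  - rewrite -sumrN; apply: eq_bigr => i _; rewrite -sumrN; apply: eq_bigr => i' _.
    by rewrite -sumrN; apply: eq_bigr => j _; rewrite phi0; ring.
have G1 : G 1 = \sum_p \sum_q sb p q * s q * ln (s q)
   - retr (rdiag (@ln R \o t) *m S).
  rewrite /G; congr (_ + _).
    by do 2 (apply: eq_bigr => ? _); rewrite lin1.
  rewrite [X in _ + X]big1 => [|i _]; last first.
    by rewrite big1 // => i' _; rewrite big1 // => j _; rewrite phi1 mulr0.
  rewrite addr0.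
  transitivity (\sum_i \sum_j \sum_j' be i j j' *
      (psi 1 (t j) (t j') 1 - ln (t j) - ln (t j'))).
    by do 3 (apply: eq_bigr => ? _); rewrite !lin1 (psi1 _ 1).
  rewrite sum_beta_ij trlnt -sumrN; apply: eq_bigr => j _.
  by rewrite psi1_diag; ring.
have := ger0_derive_le01 GdG dG_ge0; rewrite G0 G1 -trlna -trlns -trlnm.
have arith (x1 x2 x3 x4 x5 x6 : R) :
    x1 + (x2 - x3 - x4) <= x5 - x6 -> x2 + x1 + x6 <= x5 + x3 + x4.
  by clear; lra.
exact: arith.
Qed.

End RelativeEntropy.

(** * Lieb's concavity theorem in tangent form *)

Section Lieb.
Context {R : realType}.
Local Notation C := R[i].
Local Notation Re := complex.Re.
Local Notation Im := complex.Im.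

Definition mexp n (A : 'M[C]_n) : 'M[C]_n := mxf expR A.
Definition trexp n (A : 'M[C]_n) : R := retr (mexp A).

Lemma mexp_spec n (U : 'M[C]_n) a : umx U ->
  mexp (spec U a) = spec U (fun i => expR (a i)).
Proof. exact: mxf_spec. Qed.

Lemma mexp_herm n (A : 'M[C]_n) : (mexp A)^t* = mexp A.
Proof. exact: spec_herm. Qed.

Lemma trexp_spec n (U : 'M[C]_n) a : umx U ->
  trexp (spec U a) = \sum_i expR (a i).
Proof. by move=> hU; rewrite /trexp mexp_spec // retr_spec. Qed.

Lemma conj_specV n (U W : 'M[C]_n) a :
  W *m spec U a *m W^t* = spec (U *m W^t*) a.
Proof. by rewrite -[X in X *m _ *m _]trmxCK conj_spec. Qed.

Lemma trexp_conj n (W A : 'M[C]_n) : umx W -> A^t* = A ->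
  trexp (W *m A *m W^t*) = trexp A.
Proof.
move=> hW /herm_spec[U [a [hU ->]]]; rewrite conj_specV !trexp_spec //.
by apply: unitaryM => //; exact: unitary_adj.
Qed.

Lemma herm_conj n p (A : 'M[C]_n) (V : 'M[C]_(n, p)) : A^t* = A ->
  (V^t* *m A *m V)^t* = V^t* *m A *m V.
Proof. by move=> hA; rewrite !adjmxM trmxCK hA mulmxA. Qed.

(* The Frechet derivative of the logarithm at [spec U m]. *)
Definition dlog n (U : 'M[C]_n) (m : 'I_n -> R) (Z : 'M[C]_n) : 'M[C]_n :=
  U^t* *m (\matrix_(i, j)
    ((lndd (m j) (m i))%:C * (U *m Z *m U^t*) i j)) *m U.

(** In the eigenbasis only diagonal entries contribute to the trace, and there the divided
    difference [1 / m i] cancels the eigenvalue. *)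
Lemma retr_dlog_spec n (U : 'M[C]_n) (m : 'I_n -> R) Z : umx U ->
  (forall i, 0 < m i) -> retr (dlog U m Z *m spec U m) = retr Z.
Proof.
move=> hU m0; rewrite /dlog -(mulmxA _ U) unitary_spec // mulmxA retrC !mulmxA.
rewrite hU mul1mx /retr /mxtrace.
transitivity (Re (\sum_i (U *m Z *m U^t*) i i)).
  congr Re; apply: eq_bigr => i _; rewrite mul_mx_rdiagE mxE /lndd eqxx.
  rewrite mulrC mulrA -rmorphM divff ?mul1r //.
  by rewrite gt_eqF.
rewrite -[LHS]/(retr _) retrC mulmxA unitaryV // mul1mx.
done.
Qed.

Lemma mulmx_conjK n p q (U D : 'M[C]_n) (P : 'M[C]_(p, n)) (Q : 'M[C]_(n, q)) :
  umx U -> (P *m U^t*) *m (U *m D *m U^t*) *m (U *m Q) = P *m D *m Q.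
Proof.
move=> /unitaryV h.
have e m (Z : 'M[C]_(n, m)) : U^t* *m (U *m Z) = Z by rewrite mulmxA h mul1mx.
by rewrite -!mulmxA !e.
Qed.

Lemma retr_conj n (U Q A : 'M[C]_n) : umx U ->
  retr (U^t* *m Q *m U *m (U^t* *m A *m U)) = retr (Q *m A).
Proof.
move=> h; have e m (Z : 'M[C]_(n, m)) : U *m (U^t* *m Z) = Z.
  by rewrite mulmxA h mul1mx.
by rewrite -!mulmxA e (retrC (U^t*)) -!mulmxA h mulmx1.
Qed.

(** [relent_diag] is applied in the eigenbases of [Y] and [spec U l], with [S] the exponential of
    the matrix on the left. For this [S], the equality case of the Gibbs principle, all logarithmic
    terms cancel and [tr S] remains. *)
Lemma lieb_trexp n d (V : 'M[C]_(n, d)) (U : 'M[C]_n) (l : 'I_n -> R)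
    (X : 'M[C]_n) (Y : 'M[C]_d) :
  V^t* *m V = 1%:M -> umx U -> X^t* = X -> Y^t* = Y ->
  trexp (Y + V^t* *m (X - spec U l) *m V) <=
  retr (dlog U (fun i => expR (l i)) (V *m mexp Y *m V^t*) *m mexp X).
Proof.
move=> hV hU /[dup] hX /herm_spec[Ux [xi [hUx eX]]].
move=> /[dup] hY /herm_spec[Ut [tau [hUt eY]]].
have hE : (Y + V^t* *m (X - spec U l) *m V)^t* =
    Y + V^t* *m (X - spec U l) *m V.
  by rewrite adjmxD hY herm_conj // adjmxB hX spec_herm.
pose V' := U *m V *m Ut^t*; pose Ua := Ux *m U^t*.
have hUa : umx Ua by apply: unitaryM => //; exact: unitary_adj.
have V'J : V'^t* = Ut *m V^t* *m U^t*.
  by rewrite /V' !adjmxM trmxCK mulmxA.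
have hV' : V'^t* *m V' = 1%:M.
  rewrite V'J /V' !mulmxA -(mulmxA _ _ U) unitaryV // mulmx1.
  by rewrite -(mulmxA Ut) hV mulmx1.
pose E := rdiag tau + V'^t* *m (spec Ua xi - rdiag l) *m V'.
have eE : Ut *m (Y + V^t* *m (X - spec U l) *m V) *m Ut^t* = E.
  rewrite mulmxDr mulmxDl eY unitary_spec // -mulmxA hUt mulmx1; congr (_ + _).
  have <- : U *m (X - spec U l) *m U^t* = spec Ua xi - rdiag l.
    rewrite mulmxBr mulmxBl unitary_spec // -(mulmxA (rdiag l)) hU mulmx1.
    by rewrite {1}eX conj_specV.
  by rewrite V'J /V' -(mulmxA U V) mulmx_conjK // !mulmxA.
have /herm_spec[Us [sg [hUs eEs]]] : E^t* = E.
  by rewrite -eE !adjmxM trmxCK hE mulmxA.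
rewrite -(trexp_conj hUt hE) eE eEs trexp_spec //.
pose s q := expR (sg q); pose S := spec Us s.
have := @relent_diag R n d V' (fun i => expR (l i)) (fun j => expR (tau j))
  Ua (fun p => expR (xi p)) Us s hV' hUa hUs (fun=> expR_gt0 _)
  (fun=> expR_gt0 _) (fun=> expR_gt0 _) (fun=> expR_gt0 _).
rewrite -/S /=.
have -> : (@ln R \o (fun p => expR (xi p))) = xi.
  by apply/funext => ? /=; rewrite expRK.
have -> : (@ln R \o (fun p => expR (l p))) = l.
  by apply/funext => ? /=; rewrite expRK.
have -> : (@ln R \o (fun p => expR (tau p))) = tau.
  by apply/funext => ? /=; rewrite expRK.
(* The logarithm of [S] is [E], so the entropy is [tr (E S)], expanded by the definition of [E]. *)
have -> : retr (spec Us (fun q => s q * ln (s q))) =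
    retr (rdiag tau *m S) + retr (V'^t* *m spec Ua xi *m V' *m S)
    - retr (V'^t* *m rdiag l *m V' *m S).
  rewrite -retrD -retrB -mulmxDl -mulmxBl -addrA -mulmxBl -mulmxBr -/E eEs.
  rewrite (specM sg s hUs); congr retr; apply: eq_spec => q.
  by rewrite /s expRK mulrC.
have -> : retr S = \sum_i expR (sg i) by rewrite /S retr_spec.
set rhs1 := \sum_i \sum_i' _; set rhs2 := retr (_ *m mexp X).
suff -> : rhs2 = rhs1.
  have arith (x1 x2 x3 x4 x5 : R) :
    x1 + x2 + x3 <= x3 + x2 - x4 + x4 + x5 -> x1 <= x5 by clear; lra.
  exact: arith.
rewrite /rhs2 /rhs1 {rhs1 rhs2} eX mexp_spec // eY mexp_spec // /dlog.
set Q := \matrix_(i, j) _.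
have -> : spec Ux (fun i => expR (xi i)) = U^t* *m spec Ua (fun i => expR (xi i)) *m U.
  by rewrite conj_spec /Ua -mulmxA unitaryV // mulmx1.
rewrite retr_conj // /retr /mxtrace.
have eQ i' i : Q i' i = (lndd (expR (l i)) (expR (l i')))%:C *
    (V' *m rdiag (fun i => expR (tau i)) *m V'^t*) i' i.
  by rewrite mxE V'J /V' /spec !mulmxA.
rewrite cRe_sum exchange_big /=; apply: eq_bigr => i' _.
rewrite mxE cRe_sum; apply: eq_bigr => i _.
rewrite eQ [X in _ * X * _]mxE mulr_sumr mulr_suml cRe_sum.
apply: eq_bigr => j _; rewrite mul_mx_rdiagE adjmxE /alpha.
case: (V' i j) (V' i' j) (spec _ _ i i') => [? ?] [? ?] [? ?] /=.
by ring.
Qed.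

End Lieb.

(** * Ordered eigenvalues, compression, logarithm of a positive definite matrix *)

Section Eigenvalues.
Context {R : realType}.
Local Notation C := R[i].
Local Notation Re := complex.Re.
Local Notation Im := complex.Im.

Lemma char_poly_conj n (U : 'M[C]_n) (D : 'M[C]_n) : umx U ->
  char_poly (U^t* *m D *m U) = char_poly D.
Proof.
move=> hU; rewrite /char_poly.
have -> : char_poly_mx (U^t* *m D *m U) =
    map_mx polyC (U^t*) *m char_poly_mx D *m map_mx polyC U.
  rewrite /char_poly_mx mulmxBr mulmxBl !map_mxM; congr (_ - _).
  rewrite -mulmxA mul_scalar_mx -scalemxAr -map_mxM unitaryV // map_mx1.
  by rewrite scalemx1.
rewrite !det_mulmx mulrC mulrA -det_mulmx -map_mxM hU map_mx1 det1 mul1r.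
done.
Qed.

Lemma char_poly_spec n (U : 'M[C]_n) a : umx U ->
  char_poly (spec U a) = \prod_(z <- [seq (a i)%:C | i <- enum 'I_n]) ('X - z%:P).
Proof.
move=> hU; rewrite char_poly_conj // char_poly_trig; last first.
  by apply/is_trig_mxP => i j ij; rewrite rdiagE eq_sym -val_eqE gtn_eqF.
rewrite big_map big_enum /=; apply: eq_bigr => i _.
by rewrite rdiagE eqxx mulr1n.
Qed.

Lemma eigvals_spec n (U : 'M[C]_n) a : umx U ->
  eigvals (spec U a) = sort >=%R [seq a i | i <- enum 'I_n].
Proof.
move=> hU; rewrite /eigvals; case: closed_field_poly_normal => /= r.
rewrite (monicP (char_poly_monic _)) scale1r char_poly_spec // => /prod_XsubC_eq.
rewrite perm_sym => /(perm_map (@complex.Re R)) /permPl h.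
rewrite -map_comp /= in h.
apply: sorted_eq; [exact: ge_trans|exact: ge_anti| | |].
- exact/sort_sorted/ge_total.
- exact/sort_sorted/ge_total.
- rewrite perm_sort perm_sym perm_sort perm_sym.
  by apply/permPl => s; rewrite h.
Qed.

Lemma sorted_ge_nth (s : seq R) k (c : R) : sorted >=%R s -> (0 < k <= size s)%N ->
  (c <= s`_k.-1) = (k <= count (>= c) s)%N.
Proof.
case: k => // k ss /andP[_ ks] /=; apply/idP/idP => h.
  rewrite -(cat_take_drop k.+1 s) count_cat.
  suff -> : count (>= c) (take k.+1 s) = k.+1 by rewrite leq_addr.
  apply/eqP; rewrite -{2}(size_takel ks) -all_count; apply/(all_nthP 0) => i.
  rewrite size_takel // => ik; rewrite nth_take //; apply: (le_trans h).
  apply: (sorted_leq_nth ge_trans ge_refl) => //; rewrite inE.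
  exact: leq_trans ks.
rewrite leNgt; apply: contraL h => h; rewrite -ltnNge ltnS.
rewrite -(cat_take_drop k s) count_cat.
have -> : count (>= c) (drop k s) = 0%N.
  apply/eqP; rewrite -leqn0 leqNgt -has_count; apply/hasPn => x.
  move=> xs; case: (nthP 0 xs) => i.
  rewrite size_drop nth_drop => ik <-; rewrite -ltNge; apply: le_lt_trans h.
  apply: (sorted_leq_nth ge_trans ge_refl) => //; rewrite ?inE ?leq_addr //.
  by rewrite -ltn_subRL.
by rewrite addn0; apply: leq_trans (count_size _ _) _; rewrite size_takel // ltnW.
Qed.

(** Trading the sorted list for a count serves both the dimension argument of [lambda_compress] and
    the measurability of the event. *)
Lemma lambda_ge n k (U : 'M[C]_n) a (c : R) : umx U -> (1 <= k <= n)%N ->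
  (c <= lambda k (spec U a)) = (k <= #|[pred i | (c <= a i)%R]|)%N.
Proof.
move=> hU kn; rewrite /lambda eigvals_spec // sorted_ge_nth; last 2 first.
- exact/sort_sorted/ge_total.
- by rewrite size_sort size_map size_enum_ord.
congr (_ <= _)%N; transitivity (count (>= c) [seq a i | i <- enum 'I_n]).
  by apply/permP; rewrite perm_sort.
by rewrite count_map cardE enumT /enum_mem size_filter.
Qed.

Lemma le_lambda_max n (U : 'M[C]_n) a i : umx U -> a i <= lambda_max (spec U a).
Proof.
move=> hU; rewrite /lambda_max lambda_ge //; last first.
  by rewrite /= (leq_ltn_trans _ (ltn_ord i)).
by apply/card_gt0P; exists i; rewrite inE.
Qed.

Lemma qform_le_lambda_max n (A : 'M[C]_n) v : A^t* = A ->
  qform A v <= lambda_max A * qform 1%:M v.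
Proof.
move=> /herm_spec[U [a [hU ->]]]; rewrite qform_spec (qform1 _ hU) mulr_sumr.
apply: ler_sum => i _; apply: ler_wpM2r; first exact: sqnorm_ge0.
exact: le_lambda_max.
Qed.

(** A Rayleigh quotient of at least [c] forces an eigenvalue of at least [c], whose exponential is
    one term of a nonnegative sum. *)
Lemma trexp_ge n (A : 'M[C]_n) v (c : R) : A^t* = A -> v != 0 ->
  c * qform 1%:M v <= qform A v -> expR c <= trexp A.
Proof.
move=> /herm_spec[U [a [hU ->]]] v0 h.
have [i ai] : exists i, c <= a i.
  apply/existsP; apply: contraT; rewrite negb_exists => /forallP ac.
  have := qform1_gt0 v0; rewrite lt_neqAle => /andP[n0 _].
  suff : qform (spec U a) v < c * qform 1%:M v by rewrite ltNge h.
  rewrite qform_spec (qform1 _ hU) mulr_sumr.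
  have ac' i : a i < c by have := ac i; rewrite -ltNge.
  have [i wi] : exists i, sqnorm ((U *m v) i 0) != 0.
    apply/existsP; apply: contraNT n0; rewrite negb_exists => /forallP w0.
    rewrite (qform1 _ hU) big1 // => i _; have := w0 i.
    by rewrite negbK => /eqP.
  rewrite (bigD1 i) //= [ltRHS](bigD1 i) //=; apply: ltr_leD.
    by rewrite ltr_pM2r // lt_neqAle eq_sym wi sqnorm_ge0.
  by apply: ler_sum => j _; rewrite ler_wpM2r ?sqnorm_ge0 // ltW.
rewrite trexp_spec // (bigD1 i) //= ler_wpDr ?ler_expR //.
by apply: sumr_ge0 => *; exact: expR_ge0.
Qed.

Lemma trexp_le n (A : 'M[C]_n) c : A^t* = A ->
  (forall v, qform A v <= c * qform 1%:M v) -> trexp A <= n%:R * expR c.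
Proof.
move=> /herm_spec[U [a [hU ->]]] h; rewrite trexp_spec //.
have -> : n%:R * expR c = \sum_(i < n) expR c.
  by rewrite sumr_const card_ord mulr_natl.
apply: ler_sum => i _; rewrite ler_expR.
by have := h (U^t* *m delta_mx i 0); rewrite qform_eigen // qform_eigen1 // mulr1.
Qed.

Lemma trexp_ge0 n (A : 'M[C]_n) : 0 <= trexp A.
Proof.
rewrite /trexp /mexp /mxf retr_spec; last exact: spectral_umx.
by apply: sumr_ge0 => *; exact: expR_ge0.
Qed.

(* [V w] is found in the span of the eigenvectors of [Y] with eigenvalue at
   least [c]: that is a linear system of at most [n - k] equations. *)
Lemma lambda_compress n k (Y : 'M[C]_n) (V : 'M[C]_(n, (n - k + 1)%N)) (c th : R) :
  Y^t* = Y -> V^t* *m V = 1%:M -> (1 <= k <= n)%N -> 0 <= th ->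
  c <= lambda k Y -> expR (th * c) <= trexp (V^t* *m (th%:C *: Y) *m V).
Proof.
move=> hY hV kn th0; have [U [a [hU eY]]] := herm_spec hY.
rewrite {1}eY lambda_ge // => hk.
pose J := [pred i | (a i < c)%R].
have cJ : (#|J| < n - k + 1)%N.
  have := cardC [pred i | (c <= a i)%R]; rewrite card_ord.
  have -> : #|[predC [pred i | (c <= a i)%R]]| = #|J|.
    by apply: eq_card => i; rewrite !inE -ltNge.
  by move: kn hk => /andP[]; move: #|J| #|_| => x y; lia.
pose N : 'M[C]_(#|J|, n - k + 1) := \matrix_(i, j) (U *m V) (enum_val i) j.
have : kermx N^T != 0.
  rewrite kermx_eq0 /row_free mxrank_tr neq_ltn; apply/orP; left.
  exact: leq_ltn_trans (rank_leq_row _) cJ.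
move=> /rowV0Pn[w /sub_kermxP wN w0].
have {}w0 : w^T != 0 by rewrite trmx_eq0.
have {}wN : N *m w^T = 0 by rewrite -(trmxK (N *m w^T)) trmx_mul trmxK wN trmx0.
have wJ i : a i < c -> (U *m (V *m w^T)) i 0 = 0.
  move=> ai; have iJ : i \in J by rewrite inE.
  have /matrixP/(_ (enum_rank_in iJ i) 0) := wN; rewrite [X in _ = X]mxE mulmxA => <-.
  by rewrite !mxE; apply: eq_bigr => j _; rewrite [in RHS]mxE enum_rankK_in.
have hY' : (th%:C *: Y)^t* = th%:C *: Y by rewrite eY specZ spec_herm.
apply: (trexp_ge (herm_conj V hY') w0).
have -> : qform 1%:M w^T = qform 1%:M (V *m w^T).
  by rewrite -qform_conj mulmx1 hV.
rewrite qform_conj qformZ -mulrA ler_wpM2l //.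
rewrite eY qform_spec (qform1 _ hU) mulr_sumr; apply: ler_sum => i _.
have [ci|ic] := leP c (a i); first by rewrite ler_wpM2r ?sqnorm_ge0.
by rewrite wJ // /sqnorm /= expr0n /= addr0 !mulr0.
Qed.

(** The logarithm shares the eigenbasis of [M], so its comparison with [M - I] is the scalar
    [ln m <= m - 1]; no operator monotonicity is involved. *)
Lemma mxlog n (M : 'M[C]_n) : M^t* = M ->
  (forall v, v != 0 -> 0 < qform M v) ->
  exists U l, [/\ umx U, M = spec U (fun i => expR (l i)) &
    forall v, qform (spec U l) v <= qform M v - qform 1%:M v].
Proof.
move=> /herm_spec[U [m [hU ->]]] h.
have m0 i : 0 < m i.
  rewrite -(qform_eigen m i hU); apply: h; apply/eqP => e.
  have := qform_eigen1 i hU; rewrite e /qform mulmx0 mxE /= => /eqP.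
  by rewrite eq_sym oner_eq0.
exists U, (fun i => ln (m i)); split; first exact: hU.
  by apply: eq_spec => i; rewrite lnK ?posrE.
move=> v; rewrite !qform_spec (qform1 _ hU) -sumrB; apply: ler_sum => i _.
rewrite -[X in _ <= _ - X]mul1r -mulrBl ler_wpM2r ?sqnorm_ge0 //.
by have := expR_ge1Dx (ln (m i)); rewrite lnK ?posrE // -lerBrDl.
Qed.

End Eigenvalues.

(** * Polynomial approximation of the exponential *)

Section ExpApproximation.
Context {R : realType}.
Local Notation C := R[i].
Implicit Types (x : R).

(** The even exponent keeps this polynomial nonnegative on the whole line, as Fatou's lemma
    requires, while its mean is still determined by moments. *)
Definition qexp k x : R := (1 + (k.+1.*2)%:R^-1 * x) ^+ (k.+1.*2).

Lemma qexp_ge0 k x : 0 <= qexp k x.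
Proof. by rewrite /qexp -muln2 exprM sqr_ge0. Qed.

Lemma bernoulli_ge x m : 0 <= x <= 1 -> 1 - m%:R * x <= (1 - x) ^+ m.
Proof.
move=> /andP[x0 x1]; elim: m => [|m IH]; first by rewrite mul0r subr0 expr0.
rewrite exprS; apply: (@le_trans _ _ ((1 - x) * (1 - m%:R * x))).
  have : 0 <= m%:R * x ^+ 2 by rewrite mulr_ge0 ?sqr_ge0.
  by rewrite -natr1; nra.
by rewrite ler_wpM2l // subr_ge0.
Qed.

(** Write [N] for the exponent. The upper bound is [1 + x / N <= exp (x / N)]. For the lower one,
    [exp (- x) >= (1 - x / N)^N], and Bernoulli's inequality applies to [(1 - x^2 / N^2)^N]. *)
Lemma qexp_bounds k x : `|x| <= k%:R ->
  expR x * (1 - (k.+1)%:R^-1 * x ^+ 2) <= qexp k x <= expR x.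
Proof.
move=> xk; pose N : R := (k.+1.*2)%:R.
have N0 : 0 < N by rewrite ltr0n double_gt0.
have kN : k%:R <= N by rewrite ler_nat; lia.
have xN : `|N^-1 * x| <= 1.
  rewrite normrM (ger0_norm (_ : 0 <= N^-1)) ?invr_ge0 ?(ltW N0) //.
  rewrite [_ * `|x|]mulrC ler_pdivrMr // mul1r.
  exact: le_trans kN.
have [xN1 xN2] : -1 <= N^-1 * x /\ N^-1 * x <= 1.
  by move: xN; rewrite ler_norml => /andP[].
have eX y : expR y = expR (N^-1 * y) ^+ (k.+1.*2).
  by rewrite -expRM_natl -/N mulrA divff ?mul1r // gt_eqF.
apply/andP; split; last first.
  rewrite (eX x) /qexp -/N ler_pXn2r ?nnegrE ?expR_ge0 //; last by lra.
  exact: expR_ge1Dx.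
rewrite mulrC -ler_pdivlMr ?expR_gt0 // -expRN (eX (- x)) /qexp -/N -exprMn.
have y0 : 0 <= (N^-1 * x) ^+ 2 <= 1.
  rewrite sqr_ge0 /= -real_normK ?num_real // expr_le1 //.
apply: le_trans (le_trans (bernoulli_ge (k.+1.*2) y0) _).
  rewrite -/N lerD2l lerN2.
  have -> : N * (N^-1 * x) ^+ 2 = N^-1 * x ^+ 2.
    by clear -N0; field; rewrite gt_eqF.
  rewrite ler_wpM2r ?sqr_ge0 // lef_pV2 ?posrE ?ltr0n //.
  by rewrite /N ler_nat; lia.
rewrite ler_pXn2r ?nnegrE ?mulr_ge0 ?expR_ge0 //; first last.
- by lra.
- by move: y0; lra.
apply: le_trans (ler_wpM2l _ (expR_ge1Dx (N^-1 * - x))); last by lra.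
by rewrite le_eqVlt; apply/orP; left; apply/eqP; ring.
Qed.

Lemma cvg_qexp x : qexp ^~ x @ \oo --> expR x.
Proof.
apply: (@squeeze_cvgr _ _ _ _
  (fun k => expR x * (1 - k.+1%:R^-1 * x ^+ 2)) (fun=> expR x)).
- near=> k; apply: qexp_bounds; near: k; exact: nbhs_infty_ger.
- rewrite -[X in _ --> X]mulr1; apply: cvgMr.
  rewrite -[X in _ --> X]subr0; apply: cvgB; first exact: cvg_cst.
  rewrite -[X in _ --> X](mul0r (x ^+ 2)); apply: cvgMl; exact: cvg_harmonic.
- exact: cvg_cst.
Unshelve. all: by end_near. Qed.

Definition qmx k n (A : 'M[C]_n) : 'M[C]_n :=
  (1%:M + ((k.+1.*2)%:R^-1)%:C *: A) ^+ (k.+1.*2).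

Lemma qmx_spec k n (U : 'M[C]_n) a : umx U ->
  qmx k (spec U a) = spec U (fun i => qexp k (a i)).
Proof.
move=> hU; rewrite /qmx -[1%:M](spec_cst 1 hU) specZ specD specX //.
Qed.

Lemma cvg_sum_fin (I : finType) (f : I -> nat -> R) (l : I -> R) :
  (forall i, f i @ \oo --> l i) -> (fun k => \sum_i f i k) @ \oo --> \sum_i l i.
Proof.
move=> h; apply: (@cvg_big _ _ _ _ _ _ _ _ (index_enum I) f l) => //.
exact: add_continuous.
Qed.

Lemma cvg_qmx n (A : 'M[C]_n) i j : A^t* = A ->
  (fun k => complex.Re (qmx k A i j)) @ \oo --> complex.Re (mexp A i j) /\
  (fun k => complex.Im (qmx k A i j)) @ \oo --> complex.Im (mexp A i j).
Proof.
move=> /herm_spec[U [a [hU ->]]].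
rewrite mexp_spec // specE cRe_sum cIm_sum; split.
  rewrite (_ : (fun _ => _) = (fun k => \sum_l qexp k (a l) *
      complex.Re ((U l i)^*%C * U l j))); last first.
    apply/funext => k; rewrite qmx_spec // specE cRe_sum.
    by apply: eq_bigr => l _; rewrite cReMr.
  under [X in _ --> X]eq_bigr do rewrite cReMr.
  by apply: cvg_sum_fin => l; apply: cvgMl; exact: cvg_qexp.
rewrite (_ : (fun _ => _) = (fun k => \sum_l qexp k (a l) *
    complex.Im ((U l i)^*%C * U l j))); last first.
  apply/funext => k; rewrite qmx_spec // specE cIm_sum.
  by apply: eq_bigr => l _; rewrite cImMr.
under [X in _ --> X]eq_bigr do rewrite cImMr.
by apply: cvg_sum_fin => l; apply: cvgMl; exact: cvg_qexp.
Qed.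

End ExpApproximation.

(** * Measurability of matrix exponentials and of eigenvalue events *)

Section RandomMatrixMeasurability.
Context {d : measure_display} {T : measurableType d} {R : realType}.
Local Notation C := R[i].
Local Notation Re := complex.Re.
Local Notation Im := complex.Im.

Definition cmeasurable (f : T -> C) :=
  measurable_fun [set: T] (fun w => Re (f w)) /\
  measurable_fun [set: T] (fun w => Im (f w)).

Lemma cmeasurable_cst z : cmeasurable (fun=> z).
Proof. by split; exact: measurable_cst. Qed.

Lemma cmeasurableD f g :
  cmeasurable f -> cmeasurable g -> cmeasurable (fun w => f w + g w).
Proof.
move=> [f1 f2] [g1 g2]; split.
  rewrite (_ : (fun _ => _) = (fun w => Re (f w)) \+ (fun w => Re (g w))).
    exact: measurable_funD.
  by apply/funext => w /=; case: (f w) (g w) => [? ?] [].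
rewrite (_ : (fun _ => _) = (fun w => Im (f w)) \+ (fun w => Im (g w))).
  exact: measurable_funD.
by apply/funext => w /=; case: (f w) (g w) => [? ?] [].
Qed.

Lemma cmeasurableM f g :
  cmeasurable f -> cmeasurable g -> cmeasurable (fun w => f w * g w).
Proof.
move=> [f1 f2] [g1 g2]; split.
  rewrite (_ : (fun _ => _) = ((fun w => Re (f w)) \* (fun w => Re (g w)))
      \- ((fun w => Im (f w)) \* (fun w => Im (g w)))).
    by apply: measurable_funB; exact: measurable_funM.
  by apply/funext => w /=; case: (f w) (g w) => [? ?] [].
rewrite (_ : (fun _ => _) = ((fun w => Re (f w)) \* (fun w => Im (g w)))
    \+ ((fun w => Im (f w)) \* (fun w => Re (g w)))).
  by apply: measurable_funD; exact: measurable_funM.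
by apply/funext => w /=; case: (f w) (g w) => [? ?] [].
Qed.

Lemma cmeasurable_sum I (r : seq I) (P : pred I) (f : I -> T -> C) :
  (forall i, P i -> cmeasurable (f i)) ->
  cmeasurable (fun w => \sum_(i <- r | P i) f i w).
Proof.
move=> mf; elim: r => [|i r IH].
  by under eq_fun do rewrite big_nil; exact: cmeasurable_cst.
case Pi : (P i); last by under eq_fun do rewrite big_cons Pi.
under eq_fun do rewrite big_cons Pi.
by apply: cmeasurableD => //; exact: mf.
Qed.

Lemma random_mx_cst n (A : 'M[C]_n) : random_mx (fun _ : T => A).
Proof. by move=> i j; exact: cmeasurable_cst. Qed.

Lemma random_mxD n (X Y : T -> 'M[C]_n) :
  random_mx X -> random_mx Y -> random_mx (fun w => X w + Y w).
Proof.
move=> mX mY i j; apply: (@eq_ind _ _ cmeasurable (cmeasurableD (mX i j) (mY i j))).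
by apply/funext => w; rewrite mxE.
Qed.

Lemma random_mx_sum n I (r : seq I) (P : pred I) (X : I -> T -> 'M[C]_n) :
  (forall i, P i -> random_mx (X i)) ->
  random_mx (fun w => \sum_(i <- r | P i) X i w).
Proof.
move=> mX; elim: r => [|i r IH].
  by under eq_fun do rewrite big_nil; exact: random_mx_cst.
case Pi : (P i); last by under eq_fun do rewrite big_cons Pi.
under eq_fun do rewrite big_cons Pi.
by apply: random_mxD => //; exact: mX.
Qed.

(** Rectangular form of [random_mx], needed for products with [V] and its adjoint. *)
Definition random_rmx m n (X : T -> 'M[C]_(m, n)) :=
  forall i j, cmeasurable (fun w => X w i j).

Lemma random_rmx_mul m n p (X : T -> 'M[C]_(m, n)) (Y : T -> 'M[C]_(n, p)) :
  random_rmx X -> random_rmx Y -> random_rmx (fun w => X w *m Y w).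
Proof.
move=> mX mY i j; under eq_fun do rewrite mxE.
by apply: cmeasurable_sum => l _; exact: cmeasurableM.
Qed.

Lemma random_rmx_cst m n (A : 'M[C]_(m, n)) : random_rmx (fun=> A).
Proof. by move=> i j; exact: cmeasurable_cst. Qed.

Lemma random_mx_conj n p (V : 'M[C]_(n, p)) (W : 'M[C]_(p, n)) (X : T -> 'M[C]_n) :
  random_mx X -> random_mx (fun w => W *m X w *m V).
Proof.
move=> mX; apply: (random_rmx_mul _ (random_rmx_cst V)).
exact: (random_rmx_mul (random_rmx_cst W)).
Qed.

Lemma random_mxZ n (c : C) (X : T -> 'M[C]_n) :
  random_mx X -> random_mx (fun w => c *: X w).
Proof.
move=> mX i j; apply: (@eq_ind _ _ cmeasurable
  (cmeasurableM (cmeasurable_cst c) (mX i j))).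
by apply/funext => w; rewrite mxE.
Qed.

Lemma random_mxX n (X : T -> 'M[C]_n) k :
  random_mx X -> random_mx (fun w => X w ^+ k).
Proof.
move=> mX; elim: k => [|k IH]; first by under eq_fun do rewrite expr0; exact: random_mx_cst.
by under eq_fun do rewrite exprS; exact: (random_rmx_mul mX IH).
Qed.

(** The eigenbasis is chosen pointwise, with no control on its measurability; the exponential is
    instead a pointwise limit of polynomials in the entries. *)
Lemma random_mx_exp n (X : T -> 'M[C]_n) :
  random_mx X -> (forall w, (X w)^t* = X w) -> random_mx (fun w => mexp (X w)).
Proof.
move=> mX hX i j.
have mq k : random_mx (fun w => qmx k (X w)).
  apply: random_mxX; apply: random_mxD; first exact: random_mx_cst.
  exact: random_mxZ.
split.
- apply: (@measurable_fun_cvg _ _ _ _ (fun k w => Re (qmx k (X w) i j))).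
    by move=> k; have [] := mq k i j.
  by move=> w _; have [] := cvg_qmx i j (hX w).
- apply: (@measurable_fun_cvg _ _ _ _ (fun k w => Im (qmx k (X w) i j))).
    by move=> k; have [] := mq k i j.
  by move=> w _; have [] := cvg_qmx i j (hX w).
Qed.

Lemma measurable_retr n (X : T -> 'M[C]_n) :
  random_mx X -> measurable_fun [set: T] (fun w => retr (X w)).
Proof. by move=> mX; have [] := @cmeasurable_sum _ (index_enum 'I_n) predT _ (fun i _ => mX i i). Qed.

Lemma measurable_trexp n (X : T -> 'M[C]_n) :
  random_mx X -> (forall w, (X w)^t* = X w) ->
  measurable_fun [set: T] (fun w => trexp (X w)).
Proof. by move=> mX hX; apply: measurable_retr; exact: random_mx_exp. Qed.

(* Since [step k] is built from [expR] alone, the trace of [step k (Y - c)] is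
   measurable in [Y]; its limit counts the eigenvalues that are at least [c]. *)
Definition step k (x : R) := expR (- expR (- k%:R ^+ 2 * x - k%:R)).

(** The shift by [- k] makes the limit at [x = 0] equal to [1], while for [x < 0] the quadratic
    factor wins: the inner exponent is at least [k] once [k * - x >= 2]. *)
Lemma cvg_step x : (fun k => step k x) @ \oo --> ((0 <= x)%R%:R : R).
Proof.
have e0 := @cvgn_expR R.
have [x0|x0] := leP 0 x.
  apply: (@squeeze_cvgr _ _ _ _ (fun k => 1 - expR (- k%:R)) (fun=> 1)).
  - near=> k; rewrite /step; apply/andP; split; last first.
      by rewrite -expR0 ler_expR oppr_le0 expR_ge0.
    apply: le_trans (expR_ge1Dx _); rewrite lerD2l lerN2 ler_expR.
    have kx : 0 <= k%:R ^+ 2 * x by rewrite mulr_ge0 ?sqr_ge0.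
    by rewrite mulNr -[leRHS]add0r lerD2r oppr_le0.
  - by rewrite -[X in _ --> X]subr0; apply: cvgB e0; exact: cvg_cst.
  - exact: cvg_cst.
apply: (@squeeze_cvgr _ _ _ _ (fun=> 0) (fun k => expR (- k%:R))) => //.
- near=> k; rewrite expR_ge0 /= ler_expR lerN2.
  have kx : 2 <= k%:R * - x.
    rewrite -ler_pdivrMr ?oppr_gt0 //; near: k; exact: nbhs_infty_ger.
  apply: le_trans (expR_ge1Dx _).
  have k0 : 0 <= k%:R :> R by [].
  by rewrite mulNr -mulrN expr2 -mulrA; move: k0 kx; move: (k%:R * - x) (k%:R) => u v; nra.
- exact: cvg_cst.
Unshelve. all: by end_near. Qed.

Lemma measurable_lambda_ge n k (Y : T -> 'M[C]_n) c :
  random_mx Y -> (forall w, (Y w)^t* = Y w) -> (1 <= k <= n)%N ->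
  measurable [set w | c <= lambda k (Y w)].
Proof.
move=> mY hY kn.
(* An eigenvalue [a] of [Y w] becomes [- m^2 (a - c) - m], the inner exponent of
   [step m (a - c)]. *)
pose G (m : nat) w :=
  (- m%:R ^+ 2)%:C *: Y w + (m%:R ^+ 2 * c - m%:R)%:C%:M.
pose F m w := trexp ((-1)%:C *: mexp (G m w)).
have eG m w U a : umx U -> Y w = spec U a ->
    G m w = spec U (fun i => - m%:R ^+ 2 * a i + (m%:R ^+ 2 * c - m%:R)).
  by move=> hU e; rewrite /G e -(spec_cst _ hU) specZ specD.
have hG m w : (G m w)^t* = G m w.
  have [U [a [hU e]]] := herm_spec (hY w).
  by rewrite (eG _ _ _ _ hU e) spec_herm.
have mG m : random_mx (G m).
  by apply: random_mxD; [exact: random_mxZ|exact: random_mx_cst].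
pose N w : R := (#|[pred i | (c <= Re (spectral_diag (Y w) 0 i))%R]|)%:R.
have mN : measurable_fun [set: T] N.
  apply: (@measurable_fun_cvg _ _ _ _ F) => [m|w _].
    apply: measurable_trexp => [|w].
      exact: random_mxZ (random_mx_exp (mG m) (hG m)).
    have [U [a [hU e]]] := herm_spec (hY w).
    by rewrite (eG _ _ _ _ hU e) mexp_spec // specZ spec_herm.
  set a := fun i => Re (spectral_diag (Y w) 0 i).
  have eY : Y w = spec (spectralmx (Y w)) a by exact: spectral_eq.
  have hU := spectral_umx (Y w).
  have -> : F ^~ w = (fun m => \sum_i step m (a i - c)).
    apply/funext => m; rewrite /F (eG m w _ _ hU eY) mexp_spec //.
    rewrite specZ trexp_spec //; apply: eq_bigr => i _; rewrite /step.
    by congr expR; rewrite mulN1r; congr (- expR _); ring.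
  have -> : N w = \sum_i (0 <= a i - c)%R%:R.
    rewrite /N -sum1_card natr_sum big_mkcond /=; apply: eq_bigr => i _.
    by rewrite inE subr_ge0; case: ifP.
  by apply: cvg_sum_fin => i; exact: cvg_step.
have lamE w : (c <= lambda k (Y w)) =
    (k <= #|[pred i | (c <= Re (spectral_diag (Y w) 0 i))%R]|)%N.
  by rewrite {1}(spectral_eq (hY w)) lambda_ge //; exact: spectral_umx.
rewrite (_ : [set w | _] = N @^-1` `[k%:R, +oo[%classic); last first.
  by apply/seteqP; split => w /=; rewrite in_itv /= andbT ler_nat lamE.
rewrite -[X in measurable X]setTI; apply: mN => //; exact: measurable_itv.
Qed.

End RandomMatrixMeasurability.

(** * Independence: product rule for means, and groups of summands *)

Section Independence.
Context {d : measure_display} {T : measurableType d} {R : realType}.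
Variable P : probability T R.

Section Product.
Variables f g : T -> R.
Hypothesis mf : measurable_fun [set: T] f.
Hypothesis mg : measurable_fun [set: T] g.
Hypothesis indep : forall A B : set R, measurable A -> measurable B ->
  P (f @^-1` A `&` g @^-1` B) = (P (f @^-1` A) * P (g @^-1` B))%E.

Let X : {RV P >-> R} := HB.pack f (isMeasurableFun.Build _ _ _ _ f mf).
Let Y : {RV P >-> R} := HB.pack g (isMeasurableFun.Build _ _ _ _ g mg).
Let h w := (f w, g w).

Let mh : measurable_fun [set: T] h.
Proof. exact: measurable_fun_pair. Qed.

Let Z : {RV P >-> (R * R)%type} := HB.pack h (isMeasurableFun.Build _ _ _ _ h mh).

Let joint_law (A : set (R * R)) : measurable A ->
  (distribution P X \x distribution P Y)%E A = distribution P Z A.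
Proof.
by apply: product_measure_unique => B D mB mD; exact: indep.
Qed.

Let mmul : measurable_fun [set: R * R] (fun z : R * R => (z.1 * z.2)%:E).
Proof.
apply/measurable_EFinP; apply: measurable_funM.
  exact: measurable_fst.
exact: measurable_snd.
Qed.

Lemma integrable_indepM :
  P.-integrable [set: T] (EFin \o f) -> P.-integrable [set: T] (EFin \o g) ->
  P.-integrable [set: T] (fun w => (f w * g w)%:E) /\
  (\int[P]_w (f w * g w) = (\int[P]_w f w) * (\int[P]_w g w))%R.
Proof.
move=> intf intg.
have mabs : measurable_fun [set: R] (fun x : R => `|x|%:E).
  by apply/measurable_EFinP; exact: normr_measurable.
have intX : (distribution P X).-integrable [set: R] EFin.
  exact: integrable_pushforward.
have intY : (distribution P Y).-integrable [set: R] EFin.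
  exact: integrable_pushforward.
move/integrableP : (intX) => [_ hX]; move/integrableP : (intY) => [_ hY].
rewrite /= in hX hY.
(* Under the product law the mean of the absolute value is a product of two finite means; equality
   of the laws carries integrability back to [P]. *)
have intXY : (distribution P X \x distribution P Y)%E.-integrable [set: R * R]
    (fun z : R * R => (z.1 * z.2)%:E).
  apply/integrable12ltyP => //=.
  under eq_integral => x _.
    under eq_integral => y _ do rewrite normrM EFinM.
    rewrite ge0_integralZl//.
    over.
  rewrite /= ge0_integralZr//; last exact: integral_ge0.
  by apply: lte_mul_pinfty => //; [exact: integral_ge0|rewrite ge0_fin_numE // integral_ge0].
have intZ : (distribution P Z).-integrable [set: R * R]
    (fun z : R * R => (z.1 * z.2)%:E).
  apply/integrableP; split; first exact: mmul.
  move/integrableP : (intXY) => [_]; congr (_ < _)%E.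
  by apply: eq_measure_integral => A mA _; exact: joint_law.
have intfg : P.-integrable [set: T] (fun w => (f w * g w)%:E).
  apply/integrableP; split.
    by apply/measurable_EFinP; exact: measurable_funM.
  move/integrableP : (intZ) => [_]; rewrite ge0_integral_distribution //.
  by apply: measurableT_comp => //; exact: mmul.
split; first exact: intfg.
rewrite /Rintegral.
have -> : (\int[P]_w (f w * g w)%:E = \int[distribution P Z]_z (z.1 * z.2)%:E)%E.
  by rewrite integral_distribution.
have <- : (\int[distribution P X \x distribution P Y]_z (z.1 * z.2)%:E =
    \int[distribution P Z]_z (z.1 * z.2)%:E)%E.
  by apply: eq_measure_integral => A mA _; exact: joint_law.
rewrite -integral12_prod_meas1 // /fubini_F /=.
have <- : (\int[distribution P X]_x x%:E = \int[P]_w (f w)%:E)%E.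
  by rewrite integral_distribution.
have <- : (\int[distribution P Y]_x x%:E = \int[P]_w (g w)%:E)%E.
  by rewrite integral_distribution.
rewrite -fineM; try exact: integrable_fin_num.
congr fine.
under eq_integral => x _.
  under eq_integral => y _ do rewrite EFinM.
  rewrite integralZl //.
  over.
have fY : (\int[distribution P Y]_x x%:E)%E \is a fin_num.
  exact: integrable_fin_num.
by rewrite /= -(fineK fY) integralZr.
Qed.

End Product.

Section Grouping.
Local Notation C := R[i].
Variables (I : finType) (n : nat) (X : I -> T -> 'M[C]_n).
Hypothesis mX : forall j, random_mx (X j).
Hypothesis indep : independent_mx P X.

Lemma sigma_mx_measurable j A : sigma_mx (X j) A -> measurable A.
Proof.
apply: smallest_sub; first exact: sigma_algebra_measurable.
move=> _ [p [q [B [mB [|] ->]]]]; rewrite -[X in measurable X]setTI.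
  by have [h _] := mX j p q; exact: h.
by have [_ h] := mX j p q; exact: h.
Qed.

Lemma sigma_mxT j : sigma_mx (X j) setT.
Proof. exact: (@measurableT _ (g_sigma_algebraType _)). Qed.

(** A pi-system generating the sigma-algebra of the family of all [X j] with [j] in [J]; on it
    [independent_mx] gives the probabilities directly. *)
Definition group_pi (J : {set I}) : set (set T) :=
  [set A | exists F : I -> set T,
     (forall j, j \in J -> sigma_mx (X j) (F j)) /\
     A = \bigcap_(j in [set` J]) F j].

Lemma group_pi_setI J : setI_closed (group_pi J).
Proof.
move=> _ _ [F [hF ->]] [G [hG ->]]; exists (fun j => F j `&` G j); split.
  move=> j jJ.
  by apply: (@measurableI _ (g_sigma_algebraType _)); [exact: hF|exact: hG].
by rewrite bigcapI.
Qed.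

Lemma group_pi_measurable J : group_pi J `<=` measurable.
Proof.
move=> _ [F [hF ->]]; apply: fin_bigcap_measurable => // j jJ.
by apply: sigma_mx_measurable; exact: hF.
Qed.

Lemma group_piT J : group_pi J setT.
Proof.
exists (fun=> setT); split; first by move=> *; exact: sigma_mxT.
by rewrite bigcapT.
Qed.

(** For fixed [B], the finite measures sending [A] to [P (A]&[B)] and to [P B * P A] agree on the
    pi-system, hence on the sigma-algebra it generates. *)
Lemma group_indep (J : {set I}) i A B : i \notin J ->
  <<s group_pi J >> A -> sigma_mx (X i) B -> P (A `&` B) = (P A * P B)%E.
Proof.
move=> iJ hA hB; have mB := sigma_mx_measurable hB.
have PB0 : 0 <= fine (P B) by exact: fine_ge0.
have ePB : (fine (P B))%:E = P B by rewrite fineK // fin_num_measure.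
suff : mrestr P mB A = mscale (NngNum PB0) P A.
  change (P (A `&` B) = ((fine (P B))%:E * P A)%E -> P (A `&` B) = (P A * P B)%E).
  by rewrite ePB muleC.
apply: (@g_sigma_algebra_measure_unique _ R T (group_pi J)
  (@group_pi_measurable J) (fun=> setT) (fun=> group_piT J) _
  (mrestr P mB) (mscale (NngNum PB0) P) (@group_pi_setI J) _ _ A hA).
- by rewrite bigcup_const.
- move=> _ [F [hF ->]].
  change (P (\bigcap_(j in [set` J]) F j `&` B) =
    ((fine (P B))%:E * P (\bigcap_(j in [set` J]) F j))%E); rewrite ePB.
  (* One event per index of [i |: J], so that [independent_mx] applies to the enlarged index set. *)
  pose G j := if j == i then B else F j.
  have hG j : j \in i |: J -> sigma_mx (X j) (G j).
    rewrite in_setU1 /G; case: eqP => [-> _ //|_ /=]; exact: hF.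
  have GF j : j \in J -> G j = F j.
    by rewrite /G; case: eqP => // ->; rewrite (negPf iJ).
  have e : \bigcap_(j in [set` i |: J]) G j = B `&` \bigcap_(j in [set` J]) F j.
    apply/seteqP; split => [w hw|w [wB wF] j /=].
      split; first by have := hw i; rewrite /= in_setU1 eqxx /G eqxx; exact.
      by move=> j jJ; rewrite -GF //; apply: hw; rewrite /= in_setU1 jJ orbT.
    by rewrite in_setU1 => /predU1P[->|jJ]; [rewrite /G eqxx|rewrite GF //; exact: wF].
  rewrite setIC -e indep // big_setU1 //= {1}/G eqxx; congr (_ * _)%E.
  rewrite indep //; apply: eq_bigr => j jJ; rewrite GF //.
- move=> _; change (P (setT `&` B) < +oo)%E; rewrite setTI.
  by apply: le_lt_trans (probability_le1 _ mB) _; exact: ltry.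
Qed.

(** Equipping [T] with the generated sigma-algebra lets the measurability lemmas above express
    dependence on the group [J] alone. *)
Lemma random_mx_group (J : {set I}) j : j \in J ->
  @random_mx _ (g_sigma_algebraType (group_pi J)) R n (X j).
Proof.
move=> jJ.
have gen (B : set T) : sigma_mx (X j) B -> group_pi J B.
  move=> hB; exists (fun l => if l == j then B else setT); split.
    by move=> l _; case: eqP => [-> //|_]; exact: sigma_mxT.
  apply/seteqP; split => [w wB l _|w /(_ j jJ)]; last by rewrite eqxx.
  by case: eqP.
move=> p q; split => _ B mB; rewrite setTI.
  apply: sub_sigma_algebra; apply: gen; apply: sub_sigma_algebra.
  by exists p, q, B; split => //; left.
apply: sub_sigma_algebra; apply: gen; apply: sub_sigma_algebra.
by exists p, q, B; split => //; right.
Qed.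

Lemma group_sigma_measurable J A : <<s group_pi J >> A -> measurable A.
Proof.
apply: smallest_sub; [exact: sigma_algebra_measurable|exact: group_pi_measurable].
Qed.

Lemma group_pi1 i : <<s group_pi [set i] >> `<=` sigma_mx (X i).
Proof.
apply: smallest_sub; first exact: smallest_sigma_algebra.
move=> _ [F [hF ->]]; rewrite (_ : \bigcap_(_ in _) _ = F i).
  by apply: hF; rewrite inE.
apply/seteqP; split => [w /(_ i)|w wF j /=]; first by apply; rewrite /= inE.
by rewrite inE => /eqP ->.
Qed.

Lemma group_expectM (J : {set I}) i (u v : T -> R) : i \notin J ->
  @measurable_fun _ _ (g_sigma_algebraType (group_pi J)) R setT u ->
  @measurable_fun _ _ (g_sigma_algebraType (group_pi [set i])) R setT v ->
  P.-integrable [set: T] (EFin \o u) -> P.-integrable [set: T] (EFin \o v) ->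
  P.-integrable [set: T] (fun w => (u w * v w)%:E) /\
  (\int[P]_w (u w * v w) = (\int[P]_w u w) * (\int[P]_w v w))%R.
Proof.
move=> iJ mu mv.
have hu A : measurable A -> <<s group_pi J >> (u @^-1` A).
  by move=> mA; rewrite -[X in <<s _ >> X]setTI; exact: mu.
have hv A : measurable A -> <<s group_pi [set i] >> (v @^-1` A).
  by move=> mA; rewrite -[X in <<s _ >> X]setTI; exact: mv.
apply: integrable_indepM.
- by move=> _ A mA; rewrite setTI; apply: group_sigma_measurable; exact: hu.
- by move=> _ A mA; rewrite setTI; apply: group_sigma_measurable; exact: hv.
- move=> A B mA mB; apply: (group_indep iJ); first exact: hu.
  by apply: group_pi1; exact: hv.
Qed.

End Grouping.

End Independence.

(** * Expectations of random matrices and integrability of their entries *)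

Section Expectation.
Context {d : measure_display} {T : measurableType d} {R : realType}.
Variable P : probability T R.
Local Notation C := R[i].
Local Notation Re := complex.Re.
Local Notation Im := complex.Im.
Local Notation rintegrable f := (P.-integrable [set: T] (EFin \o f)).

Lemma rintegrableD (f g : T -> R) :
  rintegrable f -> rintegrable g -> rintegrable (fun w => f w + g w).
Proof. by move=> hf hg; exact: (integrableD measurableT hf hg). Qed.

Lemma rintegrable_sum (I : Type) (r : seq I) (f : I -> T -> R) :
  (forall i, rintegrable (f i)) ->
  rintegrable (fun w => \sum_(i <- r) f i w) /\
  (\int[P]_w (\sum_(i <- r) f i w) = \sum_(i <- r) \int[P]_w f i w)%R.
Proof.
move=> hf; elim: r => [|i r [IH1 IH2]].
  under eq_fun do rewrite big_nil; rewrite big_nil; split.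
    exact: finite_measure_integrable_cst.
  by rewrite Rintegral_cst // mul0r.
under eq_fun do rewrite big_cons; rewrite big_cons; split.
  exact: rintegrableD.
by rewrite RintegralD // IH2.
Qed.

Lemma rintegrableZ (c : R) (f : T -> R) :
  rintegrable f -> rintegrable (fun w => c * f w).
Proof. by move=> hf; exact: (integrableZl measurableT c hf). Qed.

Lemma rintegrableB (f g : T -> R) :
  rintegrable f -> rintegrable g -> rintegrable (fun w => f w - g w).
Proof. by move=> hf hg; exact: (integrableB measurableT hf hg). Qed.

Lemma rintegrable_cst (c : R) : rintegrable (fun=> c).
Proof. exact: finite_measure_integrable_cst. Qed.

Lemma Ex_cst (c : R) : (\int[P]_w c)%R = c.
Proof. by rewrite Rintegral_cst // [X in fine X](@probability_setT _ _ _ P) mulr1. Qed.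

Lemma retr_mulE n (K A : 'M[C]_n) : retr (K *m A) =
  \sum_(ij : 'I_n * 'I_n) (Re (K ij.1 ij.2) * Re (A ij.2 ij.1)
                           - Im (K ij.1 ij.2) * Im (A ij.2 ij.1)).
Proof.
rewrite -(pair_big predT predT (fun i j => Re (K i j) * Re (A j i) - Im (K i j) * Im (A j i))) /=.
rewrite /retr /mxtrace cRe_sum; apply: eq_bigr => i _.
by rewrite mxE cRe_sum; apply: eq_bigr => j _; rewrite cReM.
Qed.

Lemma qform_retr n (A : 'M[C]_n) v : qform A v = retr ((v *m v^t*) *m A).
Proof. by rewrite -mulmxA retrC /qform /retr trace_mx11. Qed.

Lemma expect_retr n (K : 'M[C]_n) (X : T -> 'M[C]_n) : integrable_mx P X ->
  rintegrable (fun w => retr (K *m X w)) /\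
  (\int[P]_w retr (K *m X w) = retr (K *m expect_mx P X))%R.
Proof.
move=> iX; under eq_fun do rewrite retr_mulE.
have h (ij : 'I_n * 'I_n) : rintegrable (fun w => Re (K ij.1 ij.2) * Re (X w ij.2 ij.1)
    - Im (K ij.1 ij.2) * Im (X w ij.2 ij.1)).
  by have [h1 h2] := iX ij.2 ij.1; apply: rintegrableB; exact: rintegrableZ.
have [h1 h2] := rintegrable_sum (index_enum _) h; split; first exact: h1.
rewrite h2 retr_mulE; apply: eq_bigr => -[i j] _ /=.
have [k1 k2] := iX j i.
rewrite RintegralB //; [|exact: rintegrableZ|exact: rintegrableZ].
by rewrite !RintegralZl // /expect_mx mxE /= unlock.
Qed.

Lemma expect_qform n (X : T -> 'M[C]_n) v : integrable_mx P X ->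
  rintegrable (fun w => qform (X w) v) /\
  (\int[P]_w qform (X w) v = qform (expect_mx P X) v)%R.
Proof.
move=> /(expect_retr (v *m v^t*)); rewrite -qform_retr => -[h1 h2].
by under eq_fun do rewrite qform_retr; split.
Qed.

Lemma expect_herm n (X : T -> 'M[C]_n) : (forall w, (X w)^t* = X w) ->
  integrable_mx P X -> (expect_mx P X)^t* = expect_mx P X.
Proof.
move=> hX iX; apply/matrixP => i j; rewrite adjmxE !mxE /= !unlock.
have e w : X w i j = (X w j i)^*%C by rewrite -adjmxE hX.
have eR : (fun w => (Re (X w i j))%:E) = (fun w => (Re (X w j i))%:E).
  by apply/funext => w; rewrite e cReJ.
have eI : (fun w => (Im (X w i j))%:E) = (fun w => ((-1) * Im (X w j i))%:E).
  by apply/funext => w; rewrite e; case: (X w j i) => ? ? /=; rewrite mulN1r.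
rewrite eR eI; congr (_ +i* _).
have [_ h] := iX j i.
by have := RintegralZl (-1) measurableT h; rewrite /Rintegral mulN1r => ->.
Qed.

Lemma integrable_mx_cst n (A : 'M[C]_n) : integrable_mx P (fun=> A).
Proof. by move=> i j; split; exact: rintegrable_cst. Qed.

Lemma rintegrable_le (f g : T -> R) : measurable_fun [set: T] f ->
  rintegrable g -> (forall w, `|f w| <= g w) -> rintegrable f.
Proof.
move=> mf ig fg; apply: le_integrable ig => //.
  by apply/measurable_EFinP.
by move=> w _ /=; rewrite lee_fin (le_trans (fg w)) // ler_norm.
Qed.

(** For self-adjoint [X] the diagonal of [X ^+ 2] holds the squared norms of the rows, which
    dominate each entry through [|x| <= 1 + x^2]. *)
Lemma integrable_mx_sqr n (X : T -> 'M[C]_n) : random_mx X ->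
  (forall w, (X w)^t* = X w) -> integrable_mx P (fun w => X w ^+ 2) ->
  integrable_mx P X.
Proof.
move=> mX hX i2 p q.
have [i2pp _] := i2 p p.
have ig : rintegrable (fun w => 1 + Re ((X w ^+ 2) p p)).
  by apply: rintegrableD i2pp; exact: rintegrable_cst.
have bd w : sqnorm (X w p q) <= Re ((X w ^+ 2) p p).
  have -> : Re ((X w ^+ 2) p p) = \sum_l sqnorm (X w p l).
    rewrite (_ : X w ^+ 2 = X w *m X w); last exact: expr2.
    rewrite mxE cRe_sum; apply: eq_bigr => l _.
    by rewrite -{2}(hX w) adjmxE mulrC cReJM.
  by rewrite (bigD1 q) //= lerDl sumr_ge0 // => *; exact: sqnorm_ge0.
have le1 (x : R) : `|x| <= 1 + x ^+ 2.
  rewrite ler_norml; apply/andP; split; nra.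
have [m1 m2] := mX p q.
split; apply: (rintegrable_le _ ig) => // w; apply: le_trans (le1 _) _;
  rewrite lerD2l; apply: le_trans (bd w); rewrite /sqnorm.
- by rewrite lerDl sqr_ge0.
- by rewrite lerDr sqr_ge0.
Qed.

(** Entries of a unitary matrix have modulus at most one, so a finite mean of the trace is enough
    for all entries of the exponential to be integrable. *)
Lemma mexp_entry_le n (A : 'M[C]_n) i j : A^t* = A ->
  `|Re (mexp A i j)| <= trexp A /\ `|Im (mexp A i j)| <= trexp A.
Proof.
move=> /herm_spec[U [a [hU ->]]]; rewrite trexp_spec // mexp_spec // specE.
have u1 l p : sqnorm (U l p) <= 1.
  have /matrixP/(_ l l)/(congr1 (@complex.Re R)) := hU.
  rewrite !mxE eqxx /= cRe_sum => <-; rewrite (bigD1 p) //=.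
  by rewrite adjmxE mulrC cReJM lerDl sumr_ge0 // => q _; rewrite adjmxE mulrC cReJM sqnorm_ge0.
have key (x y : C) : sqnorm x <= 1 -> sqnorm y <= 1 ->
    `|Re (x^*%C * y)| <= 1 /\ `|Im (x^*%C * y)| <= 1.
  case: x y => [p q] [r s]; rewrite /sqnorm /= => h1 h2.
  have := conj (sqr_ge0 (p - r)) (sqr_ge0 (p + r)).
  have := conj (sqr_ge0 (q - s)) (sqr_ge0 (q + s)).
  have := conj (sqr_ge0 (p - s)) (sqr_ge0 (p + s)).
  have := conj (sqr_ge0 (q - r)) (sqr_ge0 (q + r)).
  move=> [a1 a2] [a3 a4] [a5 a6] [a7 a8].
  by rewrite !ler_norml; split; apply/andP; split; nra.
rewrite cRe_sum cIm_sum; split; apply: le_trans (ler_norm_sum _ _ _) _;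
  apply: ler_sum => l _; have [k1 k2] := key _ _ (u1 l i) (u1 l j).
- by rewrite cReMr normrM (ger0_norm (expR_ge0 _)) ler_piMr // expR_ge0.
- by rewrite cImMr normrM (ger0_norm (expR_ge0 _)) ler_piMr // expR_ge0.
Qed.

Lemma integrable_mexp n (X : T -> 'M[C]_n) : random_mx X ->
  (forall w, (X w)^t* = X w) -> (\int[P]_w (trexp (X w))%:E < +oo)%E ->
  rintegrable (fun w => trexp (X w)) /\ integrable_mx P (fun w => mexp (X w)).
Proof.
move=> mX hX fin.
have it : rintegrable (fun w => trexp (X w)).
  apply/integrableP; split.
    by apply/measurable_EFinP; exact: measurable_trexp.
  by under eq_integral do rewrite /= ger0_norm ?trexp_ge0 //.
split=> // i j; have [m1 m2] := random_mx_exp mX hX i j.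
by split; apply: (rintegrable_le _ it) => // w; have [] := mexp_entry_le i j (hX w).
Qed.

End Expectation.

(** * The matrix moment generating function under the moment condition *)

Section MomentGenerating.
Context {d : measure_display} {T : measurableType d} {R : realType}.
Variable P : probability T R.
Local Notation C := R[i].
Local Notation Re := complex.Re.
Local Notation Im := complex.Im.
Local Notation rintegrable f := (P.-integrable [set: T] (EFin \o f)).

Lemma limn_einf_le (u : nat -> \bar R) c : (forall k, u k <= c)%E -> (limn_einf u <= c)%E.
Proof.
move=> h; rewrite limn_einf_lim; apply: lime_le; first exact: is_cvg_einfs.
apply: nearW => k; apply: le_trans (h k); apply: ereal_inf_lbound.
by exists k => /=.
Qed.

Lemma ffact_le_expn N m : (N ^_ m <= N ^ m)%N.
Proof.
elim: m => [|m IH]; first by rewrite ffactn0 expn0.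
by rewrite ffactnSr expnSr leq_mul // leq_subr.
Qed.

(** The coefficients of [(1 + x / N)^N] do not exceed those of the exponential; this absorbs the
    factorial of the moment condition. *)
Lemma bin_coef_le N m : (0 < N)%N ->
  ('C(N, m))%:R * (N%:R^-1) ^+ m * (m`!)%:R <= 1 :> R.
Proof.
move=> N0; rewrite mulrAC -natrM bin_ffact exprVn ler_pdivrMr ?exprn_gt0 ?ltr0n //.
by rewrite mul1r -natrX ler_nat ffact_le_expn.
Qed.

Lemma geometric_le (r : R) K : 0 <= r < 1 -> \sum_(i < K) r ^+ i <= (1 - r)^-1.
Proof.
move=> /andP[r0 r1]; have h : 0 < 1 - r by rewrite subr_gt0.
rewrite -(ler_pM2l h) divff ?gt_eqF // -opprB mulNr -subrX1 opprB.
by rewrite gerBl exprn_ge0.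
Qed.

Lemma retr_qform n (A : 'M[C]_n) : retr A = \sum_p qform A (delta_mx p 0).
Proof.
rewrite /retr /mxtrace cRe_sum; apply: eq_bigr => p _; rewrite /qform.
have e q : ((delta_mx p 0 : 'cV[C]_n)^t*) 0 q = (q == p)%:R.
  by rewrite adjmxE mxE andbT; case: eqP => _; rewrite ?conjc1 ?conjc0.
rewrite -mulmxA -colE [in RHS]mxE (bigD1 p) //= big1 ?addr0 => [|q qp].
  by rewrite e eqxx mul1r mxE.
by rewrite e (negPf qp) mul0r.
Qed.

Lemma qform_qmx n (A : 'M[C]_n) v k (th : R) : A^t* = A ->
  qform (qmx k (th%:C *: A)) v = \sum_(m < (k.+1.*2).+1)
    ('C(k.+1.*2, m))%:R * ((k.+1.*2)%:R^-1) ^+ m * th ^+ m * qform (A ^+ m) v.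
Proof.
move=> /herm_spec[U [a [hU ->]]]; rewrite specZ qmx_spec // qform_spec.
under [RHS]eq_bigr do rewrite specX // qform_spec mulr_sumr.
rewrite exchange_big /=; apply: eq_bigr => i _.
rewrite /qexp exprDn mulr_suml; apply: eq_bigr => m _.
by rewrite expr1n mul1r -mulr_natl !exprMn; ring.
Qed.

Lemma qform_mexp_ge n (A : 'M[C]_n) v c : A^t* = A ->
  expR c * ((1 - c) * qform 1%:M v + qform A v) <= qform (mexp A) v.
Proof.
move=> /herm_spec[U [a [hU ->]]]; rewrite mexp_spec //.
rewrite !qform_spec (qform1 _ hU) mulr_sumr -big_split mulr_sumr /=.
apply: ler_sum => i _; rewrite -mulrDl mulrA ler_wpM2r ?sqnorm_ge0 //.
rewrite -[X in _ <= expR X](subrKC c) expRD ler_wpM2l ?expR_ge0 //.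
by apply: le_trans (expR_ge1Dx _); rewrite addrAC -addrA.
Qed.

Section Subexponential.
Variables (n : nat) (X : T -> 'M[C]_n) (S : 'M[C]_n) (B th : R).
Hypothesis mX : random_mx X.
Hypothesis hX : forall w, (X w)^t* = X w.
Hypothesis B0 : 0 < B.
Hypothesis psdS : psdmx S.
Hypothesis mom : subexp_moments P B S X.
Hypothesis th0 : 0 <= th.
Hypothesis thB : th * B < 1.

Lemma subexp_integrable m : integrable_mx P (fun w => X w ^+ m).
Proof.
case: m => [|[|m]].
- by under eq_fun do rewrite expr0; exact: integrable_mx_cst.
- under eq_fun do rewrite expr1; apply: integrable_mx_sqr => //.
  by have [] := mom (leqnn 2).
- by have [] := @mom m.+2 isT.
Qed.

Lemma subexp_integrable1 : integrable_mx P X.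
Proof. by have := subexp_integrable 1; under eq_fun do rewrite expr1. Qed.

Definition mgf_bound v := qform 1%:M v + th * qform (expect_mx P X) v
  + th ^+ 2 / (2 * (1 - th * B)) * qform S v.

(** The terms of degree 0 and 1 are exact; the bounds on those of degree [i + 2] form a geometric
    series of ratio [th * B < 1], whose sum does not depend on [k]. *)
Lemma expect_qform_qmx_le v k :
  (\int[P]_w (qform (qmx k (th%:C *: X w)) v)%:E <= (mgf_bound v)%:E)%E.
Proof.
pose c m : R := ('C(k.+1.*2, m))%:R * ((k.+1.*2)%:R^-1) ^+ m * th ^+ m.
have hi (m : 'I_(k.+1.*2).+1) : rintegrable (fun w => c m * qform (X w ^+ m) v).
  by apply: rintegrableZ; have [] := expect_qform v (subexp_integrable m).
have [h1 h2] := rintegrable_sum (index_enum _) hi.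
have -> : (fun w => (qform (qmx k (th%:C *: X w)) v)%:E) =
    EFin \o (fun w => \sum_(m < (k.+1.*2).+1) c m * qform (X w ^+ m) v).
  by apply/funext => w; rewrite qform_qmx.
rewrite -[leLHS]fineK ?integrable_fin_num // lee_fin.
rewrite -[fine _]/(\int[P]_w _)%R h2.
have eE m : \int[P]_w (c m * qform (X w ^+ m) v) =
    c m * qform (expect_mx P (fun w => X w ^+ m)) v.
  by have [k1 k2] := expect_qform v (subexp_integrable m); rewrite RintegralZl // k2.
under eq_bigr do rewrite eE.
rewrite big_ord_recl big_ord_recl /=.
have -> : c 0%N * qform (expect_mx P (fun w => X w ^+ 0)) v = qform 1%:M v.
  have [_ <-] := expect_qform v (subexp_integrable 0).
  under eq_Rintegral do rewrite expr0.
  by rewrite Ex_cst /c bin0 !expr0 !mulr1 mul1r.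
have -> : c (bump 0 0) * qform (expect_mx P (fun w => X w ^+ bump 0 0)) v =
    th * qform (expect_mx P X) v.
  have -> : (fun w => X w ^+ bump 0 0) = X by apply/funext => w; rewrite expr1.
  by rewrite /c bin1 !expr1 mulfV ?mul1r // pnatr_eq0.
rewrite /mgf_bound -addrA lerD2l lerD2l.
have S0 : 0 <= qform S v by exact: psdmx_qform.
apply: (@le_trans _ _ (\sum_(i < k.*2.+1) th ^+ 2 / 2 * qform S v * (th * B) ^+ i)).
  apply: ler_sum => i _; rewrite /bump /= !add1n.
  have [_ /(psdmx_qform v)] := @mom i.+2 isT.
  rewrite qformB qformZ subr_ge0 subSS subSS subn0 => le1.
  have c0 : 0 <= c i.+2.
    apply: mulr_ge0; last exact: exprn_ge0.
    by apply: mulr_ge0 => //; rewrite exprn_ge0 // invr_ge0.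
  apply: le_trans (ler_wpM2l c0 le1) _.
  rewrite /c; have := @bin_coef_le k.+1.*2 i.+2 isT; set x := _ * _ ^+ _ => xle.
  rewrite [leLHS](_ : _ = (x * (i.+2)`!%:R) * (th ^+ 2 / 2 * qform S v * (th * B) ^+ i)).
    by rewrite ler_piMl // !mulr_ge0 ?exprn_ge0 ?mulr_ge0 // ltW.
  by rewrite exprMn -addn2 addnC exprD; ring.
rewrite -mulr_sumr.
have -> : th ^+ 2 / (2 * (1 - th * B)) * qform S v =
    th ^+ 2 / 2 * qform S v * (1 - th * B)^-1.
  by rewrite invfM; ring.
rewrite ler_wpM2l ?mulr_ge0 ?exprn_ge0 //.
by apply: geometric_le; rewrite thB andbT; exact: mulr_ge0 th0 (ltW B0).
Qed.

Lemma hthX w : (th%:C *: X w)^t* = th%:C *: X w.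
Proof.
by have [U [a [hU e]]] := herm_spec (hX w); rewrite e specZ spec_herm.
Qed.

Lemma mthX : random_mx (fun w => th%:C *: X w).
Proof. exact: random_mxZ. Qed.

Lemma measurable_qform (Y : T -> 'M[C]_n) v :
  random_mx Y -> measurable_fun [set: T] (fun w => qform (Y w) v).
Proof.
move=> mY; under eq_fun do rewrite qform_retr; apply: measurable_retr.
exact: (random_rmx_mul (random_rmx_cst _) mY).
Qed.

Lemma cvg_qform_qmx (A : 'M[C]_n) v : A^t* = A ->
  (fun k => qform (qmx k A) v) @ \oo --> qform (mexp A) v.
Proof.
move=> /herm_spec[U [a [hU ->]]]; rewrite mexp_spec // qform_spec.
under eq_fun do rewrite qmx_spec // qform_spec.
by apply: cvg_sum_fin => i; apply: cvgMl; exact: cvg_qexp.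
Qed.

(** The integral on the left could a priori be infinite; Fatou's lemma bounds it without a
    dominating function, and integrability of the exponential follows from this bound. *)
Lemma expect_qform_mexp_le v :
  (\int[P]_w (qform (mexp (th%:C *: X w)) v)%:E <= (mgf_bound v)%:E)%E.
Proof.
pose f k w := (qform (qmx k (th%:C *: X w)) v)%:E.
have mq k : random_mx (fun w => qmx k (th%:C *: X w)).
  apply: random_mxX; apply: random_mxD; first exact: random_mx_cst.
  exact: random_mxZ mthX.
have mf k : measurable_fun [set: T] (f k).
  by apply/measurable_EFinP; exact: measurable_qform.
have f0 k w : [set: T] w -> (0 <= f k w)%E.
  move=> _; rewrite /f lee_fin; have [U [a [hU e]]] := herm_spec (hthX w).
  rewrite e qmx_spec // qform_spec sumr_ge0 // => i _.
  by rewrite mulr_ge0 ?qexp_ge0 ?sqnorm_ge0.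
have := fatou P measurableT mf f0.
have -> : (fun w => limn_einf (f ^~ w)) = (fun w => (qform (mexp (th%:C *: X w)) v)%:E).
  apply/funext => w.
  have cv : f ^~ w @ \oo --> (qform (mexp (th%:C *: X w)) v)%:E.
    by apply: cvg_EFin; [exact: nearW|exact: cvg_qform_qmx (hthX w)].
  by have [-> _] := cvg_limn_einf_sup cv.
move=> /le_trans; apply; apply: limn_einf_le => k; exact: expect_qform_qmx_le.
Qed.

Lemma qform_mexp_ge0 (A : 'M[C]_n) v : A^t* = A -> 0 <= qform (mexp A) v.
Proof.
move=> /herm_spec[U [a [hU ->]]]; rewrite mexp_spec // qform_spec sumr_ge0 //.
by move=> i _; rewrite mulr_ge0 ?expR_ge0 ?sqnorm_ge0.
Qed.

Lemma mgf_integrable : integrable_mx P (fun w => mexp (th%:C *: X w)).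
Proof.
have iq v : rintegrable (fun w => qform (mexp (th%:C *: X w)) v).
  apply/integrableP; split.
    apply/measurable_EFinP; apply: measurable_qform.
    exact: random_mx_exp mthX hthX.
  under eq_integral do rewrite /= ger0_norm ?qform_mexp_ge0 ?hthX //.
  by apply: le_lt_trans (expect_qform_mexp_le v) _; exact: ltry.
have [it _] := rintegrable_sum (index_enum _) (fun p : 'I_n => iq (delta_mx p 0)).
have [] // := @integrable_mexp _ _ _ P n _ mthX hthX.
under eq_integral do rewrite /trexp retr_qform.
exact: integrable_lty.
Qed.

Let M := expect_mx P (fun w => mexp (th%:C *: X w)).

Lemma mgf_herm : M^t* = M.
Proof. by apply: expect_herm mgf_integrable => w; exact: mexp_herm. Qed.

Lemma mgf_le v : qform M v <= mgf_bound v.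
Proof.
have [h <-] := expect_qform v mgf_integrable.
rewrite -lee_fin fineK ?expect_qform_mexp_le //.
exact: integrable_fin_num.
Qed.

Lemma mgf_gt0 v : v != 0 -> 0 < qform M v.
Proof.
move=> v0; have s0 := qform1_gt0 v0; set s := qform 1%:M v in s0.
(* Jensen, through the tangent [exp x >= exp c * (1 - c + x)] at the mean [c]. *)
pose c := th * qform (expect_mx P X) v / s.
have [h1 <-] := expect_qform v mgf_integrable.
have [i1 e1] := expect_qform v subexp_integrable1.
have ig : rintegrable (fun w => expR c * ((1 - c) * s + th * qform (X w) v)).
  by apply: rintegrableZ; apply: rintegrableD; [exact: rintegrable_cst|exact: rintegrableZ].
apply: (@lt_le_trans _ _ (\int[P]_w (expR c * ((1 - c) * s + th * qform (X w) v)))%R).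
  rewrite RintegralZl //; last first.
    by apply: rintegrableD; [exact: rintegrable_cst|exact: rintegrableZ].
  rewrite RintegralD //; [|exact: rintegrable_cst|exact: rintegrableZ].
  rewrite Ex_cst RintegralZl // e1 mulr_gt0 ?expR_gt0 //.
  have -> : (1 - c) * s + th * qform (expect_mx P X) v = s; last exact: s0.
  have arith (q r : R) : 0 < r -> (1 - q / r) * r + q = r.
    by move=> r0; rewrite mulrBl mul1r divfK ?gt_eqF // subrK.
  exact: arith.
apply: le_Rintegral; [exact: measurableT|exact: ig|exact: h1|move=> w _].
by rewrite -(qformZ th (X w)); exact: qform_mexp_ge (hthX w).
Qed.

End Subexponential.
End MomentGenerating.

(** * Replacing the summands one at a time by deterministic logarithms *)

Section DlogMeasurability.
Context {d : measure_display} {T : measurableType d} {R : realType}.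
Local Notation C := R[i].

Lemma random_mx_dlog n (U : 'M[C]_n) (m : 'I_n -> R) (Z : T -> 'M[C]_n) :
  random_mx Z -> random_mx (fun w => dlog U m (Z w)).
Proof.
move=> mZ; apply: random_mx_conj => i j.
have := cmeasurableM (cmeasurable_cst (lndd (m j) (m i))%:C)
  (random_mx_conj (U^t*) U mZ i j).
by congr cmeasurable; apply/funext => w; rewrite [RHS]mxE.
Qed.

End DlogMeasurability.

Section Subadditivity.
Context {d : measure_display} {T : measurableType d} {R : realType}.
Variable P : probability T R.
Local Notation C := R[i].
Local Notation Re := complex.Re.
Local Notation Im := complex.Im.
Local Notation rintegrable f := (P.-integrable [set: T] (EFin \o f)).

Definition cintegrable (f : T -> C) :=
  rintegrable (fun w => Re (f w)) /\ rintegrable (fun w => Im (f w)).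

Lemma cintegrableZ (c : C) f : cintegrable f -> cintegrable (fun w => c * f w).
Proof.
move=> [f1 f2]; split.
  rewrite (_ : (fun _ => _) = (fun w => Re c * Re (f w) - Im c * Im (f w))).
    by apply: rintegrableB; exact: rintegrableZ.
  by apply/funext => w; rewrite cReM.
rewrite (_ : (fun _ => _) = (fun w => Re c * Im (f w) + Im c * Re (f w))).
  by apply: rintegrableD; exact: rintegrableZ.
by apply/funext => w; case: c (f w) => ? ? [].
Qed.

Lemma cintegrable_sum (I : Type) (r : seq I) (f : I -> T -> C) :
  (forall i, cintegrable (f i)) -> cintegrable (fun w => \sum_(i <- r) f i w).
Proof.
move=> hf; split.
  under eq_fun do rewrite cRe_sum.
  by have [] := rintegrable_sum r (fun i => (hf i).1).
under eq_fun do rewrite cIm_sum.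
by have [] := rintegrable_sum r (fun i => (hf i).2).
Qed.

Lemma cintegrable_conj m n p q (A : 'M[C]_(m, n)) (B : 'M[C]_(p, q))
    (Z : T -> 'M[C]_(n, p)) : (forall i j, cintegrable (fun w => Z w i j)) ->
  forall i j, cintegrable (fun w => (A *m Z w *m B) i j).
Proof.
move=> iZ i j; under eq_fun do rewrite mxE.
apply: cintegrable_sum => l; under eq_fun do rewrite mulrC mxE.
by apply: cintegrableZ; apply: cintegrable_sum => s; exact: cintegrableZ.
Qed.

Lemma integrable_mx_dlog n (U : 'M[C]_n) (m : 'I_n -> R) (Z : T -> 'M[C]_n) :
  integrable_mx P Z -> integrable_mx P (fun w => dlog U m (Z w)).
Proof.
move=> iZ; apply: cintegrable_conj => i j; under eq_fun do rewrite mxE.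
by apply: cintegrableZ; exact: cintegrable_conj.
Qed.

Section Induction.
Variables (I : finType) (n p : nat) (X : I -> T -> 'M[C]_n) (V : 'M[C]_(n, p)).
Hypothesis mX : forall j, random_mx (X j).
Hypothesis hX : forall j w, (X j w)^t* = X j w.
Hypothesis indep : independent_mx P X.
Hypothesis hV : V^t* *m V = 1%:M.

(** The trace is a sum of products of an entry of [K] with an entry of [A], and the two come from
    disjoint groups of summands. *)
Lemma expect_retr_indep (J : {set I}) i (K A : T -> 'M[C]_n) : i \notin J ->
  @random_mx _ (g_sigma_algebraType (group_pi X J)) R n K ->
  @random_mx _ (g_sigma_algebraType (group_pi X [set i])) R n A ->
  integrable_mx P K -> integrable_mx P A ->
  rintegrable (fun w => retr (K w *m A w)) /\
  (\int[P]_w retr (K w *m A w) = \int[P]_w retr (K w *m expect_mx P A))%R.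
Proof.
move=> iJ mK mA iK iA; under eq_fun do rewrite retr_mulE.
have E (u v : T -> R) := @group_expectM _ _ _ P _ _ _ mX indep J i u v iJ.
have h1 (ij : 'I_n * 'I_n) := E _ _ (mK ij.1 ij.2).1 (mA ij.2 ij.1).1
  (iK ij.1 ij.2).1 (iA ij.2 ij.1).1.
have h2 (ij : 'I_n * 'I_n) := E _ _ (mK ij.1 ij.2).2 (mA ij.2 ij.1).2
  (iK ij.1 ij.2).2 (iA ij.2 ij.1).2.
have h (ij : 'I_n * 'I_n) := rintegrableB (h1 ij).1 (h2 ij).1.
have [k1 k2] := rintegrable_sum (index_enum _) h; split; first exact: k1.
have g (ij : 'I_n * 'I_n) : rintegrable (fun w =>
    Re (K w ij.1 ij.2) * Re (expect_mx P A ij.2 ij.1) -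
    Im (K w ij.1 ij.2) * Im (expect_mx P A ij.2 ij.1)).
  under eq_fun do rewrite mulrC [Im (K _ _ _) * _]mulrC.
  by apply: rintegrableB; apply: rintegrableZ; [exact: (iK _ _).1|exact: (iK _ _).2].
have [g1 g2] := rintegrable_sum (index_enum _) g.
under [RHS]eq_Rintegral do rewrite retr_mulE.
rewrite k2 g2; apply: eq_bigr => -[a b] _ /=.
have [kR kI] := iK a b.
rewrite RintegralB //; [|exact: (h1 (a, b)).1|exact: (h2 (a, b)).1].
rewrite (h1 (a, b)).2 (h2 (a, b)).2 /=.
rewrite RintegralB //; last 2 first.
- by under eq_fun do rewrite mulrC; exact: rintegrableZ.
- by under eq_fun do rewrite mulrC; exact: rintegrableZ.
by rewrite !RintegralZr // /expect_mx !mxE /= unlock.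
Qed.

Variables (th : R) (U : I -> 'M[C]_n) (l : I -> 'I_n -> R).
Hypothesis iA : forall j, integrable_mx P (fun w => mexp (th%:C *: X j w)).
Hypothesis hU : forall j, umx (U j).
Hypothesis eM : forall j, expect_mx P (fun w => mexp (th%:C *: X j w)) =
  spec (U j) (fun i => expR (l j i)).

Let thX j w := th%:C *: X j w.

Let hermthX j w : (thX j w)^t* = thX j w.
Proof. exact: hthX. Qed.

Lemma herm_sum_conj (J : {set I}) (H : 'M[C]_p) (Z : I -> 'M[C]_n) :
  H^t* = H -> (forall j, (Z j)^t* = Z j) ->
  (H + \sum_(j in J) V^t* *m Z j *m V)^t* = H + \sum_(j in J) V^t* *m Z j *m V.
Proof.
move=> hH hZ; rewrite adjmxD hH adjmx_sum; congr (_ + _).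
by apply: eq_bigr => j _; exact: herm_conj.
Qed.

(** The deterministic part [H] is kept arbitrary in the induction on the size of [J], since it
    collects the compressed logarithms of the summands already replaced. *)
Lemma expect_trexp_le (J : {set I}) (H : 'M[C]_p) : H^t* = H ->
  (\int[P]_w (trexp (H + \sum_(j in J) V^t* *m thX j w *m V))%:E <=
   (trexp (H + \sum_(j in J) V^t* *m spec (U j) (l j) *m V))%:E)%E.
Proof.
have [m] := ubnP #|J|; elim: m J H => // m IH J H Jm hH.
have [->|[i iJ]] := set_0Vmem J.
  under eq_integral do rewrite big_set0 addr0.
  by rewrite big_set0 addr0 integral_cst // [X in (_ * X)%E]probability_setT mule1.
pose J' := J :\ i; pose Q := V^t* *m spec (U i) (l i) *m V.
have hQ : Q^t* = Q by apply: herm_conj; exact: spec_herm.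
have hHQ : (H + Q)^t* = H + Q by rewrite adjmxD hH hQ.
have iJ' : i \notin J' by rewrite !inE eqxx.
have J'm : (#|J'| < m)%N by rewrite -ltnS (leq_trans _ Jm) // (cardsD1 i J) iJ.
have {}IH := IH J' (H + Q) J'm hHQ.
have sE (F : I -> 'M[C]_p) : \sum_(j in J) F j = F i + \sum_(j in J') F j.
  exact: big_setD1.
rewrite [in leRHS](sE (fun j => V^t* *m spec (U j) (l j) *m V)) [in leRHS]addrA.
pose Y w := H + Q + \sum_(j in J') V^t* *m thX j w *m V.
have hY w : (Y w)^t* = Y w by apply: herm_sum_conj => // j; exact: hermthX.
(* The measurable space is left open: the fact is used for the ambient sigma-algebra and for the one
   generated by [J']. *)
have mYgen d' (T' : measurableType d') (Z : I -> T' -> 'M[C]_n) :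
    (forall j, j \in J' -> random_mx (Z j)) ->
    random_mx (fun w => H + Q + \sum_(j in J') V^t* *m (th%:C *: Z j w) *m V).
  move=> mZ; apply: random_mxD; first exact: random_mx_cst.
  apply: random_mx_sum => j jJ'; apply: random_mx_conj; apply: random_mxZ.
  exact: mZ.
have mY : random_mx Y by apply: mYgen => j _; exact: mX.
have mYJ : @random_mx _ (g_sigma_algebraType (group_pi X J')) R p Y.
  by apply: mYgen => j jJ'; exact: random_mx_group.
(* The induction hypothesis is used first for finiteness, which makes [exp Y], and with it [K],
   integrable. *)
have fin : (\int[P]_w (trexp (Y w))%:E < +oo)%E.
  by apply: le_lt_trans IH _; exact: ltry.
apply: le_trans IH; rewrite -/(Y _).
have [itY iY] := integrable_mexp mY hY fin.
pose K w := dlog (U i) (fun a => expR (l i a)) (V *m mexp (Y w) *m V^t*).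
have iK : integrable_mx P K.
  by apply: integrable_mx_dlog; exact: cintegrable_conj.
have mK : @random_mx _ (g_sigma_algebraType (group_pi X J')) R n K.
  apply: random_mx_dlog; apply: (random_rmx_mul _ (random_rmx_cst _)).
  apply: (random_rmx_mul (random_rmx_cst _)); exact: random_mx_exp mYJ hY.
have mA : @random_mx _ (g_sigma_algebraType (group_pi X [set i])) R n
    (fun w => mexp (thX i w)).
  apply: (@random_mx_exp _ (g_sigma_algebraType (group_pi X [set i])) R n
    (thX i) _ (hermthX i)); apply: random_mxZ; apply: random_mx_group.
  by rewrite inE.
have [r1 r2] := expect_retr_indep iJ' mK mA iK (iA i).
have shift (a x s q : 'M[C]_p) : a + (x + s) = a + q + s + (x - q).
  by rewrite -!addrA [q + _]addrCA [q + _]addrCA subrr addr0 [x + s]addrC.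
have lieb w : trexp (H + \sum_(j in J) V^t* *m thX j w *m V) <=
    retr (K w *m mexp (thX i w)).
  apply: le_trans (lieb_trexp (l i) hV (hU i) (hermthX i w) (hY w)).
  rewrite (sE (fun j => V^t* *m thX j w *m V)) mulmxBr mulmxBl -/Q /Y.
  rewrite le_eqVlt; apply/orP; left; apply/eqP; congr trexp.
  exact: shift.
(* The tangent inequality is exact at the mean, where [spec (U i) (l i)] is the logarithm. *)
have KM w : retr (K w *m expect_mx P (fun w => mexp (thX i w))) = trexp (Y w).
  rewrite (eM i); apply: etrans (@retr_dlog_spec R n (U i) _
    (V *m mexp (Y w) *m V^t*) (hU i) (fun a => expR_gt0 (l i a))) _.
  by rewrite retrC mulmxA hV mul1mx.
apply: (@le_trans _ _ (\int[P]_w (retr (K w *m mexp (thX i w)))%:E)%E).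
  apply: ge0_le_integral; first exact: measurableT.
  - by move=> w _; rewrite lee_fin; exact: trexp_ge0.
  - apply/measurable_EFinP; apply: measurable_trexp => [|w].
      apply: random_mxD; first exact: random_mx_cst.
      apply: random_mx_sum => j _; apply: random_mx_conj; apply: random_mxZ.
      exact: mX.
    by apply: herm_sum_conj => // j; exact: hermthX.
  - by case/integrableP : r1.
  - by move=> w _; rewrite lee_fin; exact: lieb.
rewrite -(fineK (integrable_fin_num measurableT r1)).
rewrite -(fineK (integrable_fin_num measurableT itY)) lee_fin.
rewrite -![fine _]/(\int[P]_w _)%R [leLHS]r2.
by under eq_Rintegral do rewrite KM.
Qed.

End Induction.
End Subadditivity.

(** * The Laplace transform bound and the choice of its parameter *)

Section Tail.
Context {d : measure_display} {T : measurableType d} {R : realType}.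
Variable P : probability T R.
Local Notation C := R[i].

Lemma herm_sum (I : Type) (r : seq I) n (F : I -> 'M[C]_n) :
  (forall i, (F i)^t* = F i) -> (\sum_(i <- r) F i)^t* = \sum_(i <- r) F i.
Proof. by move=> h; rewrite adjmx_sum; apply: eq_bigr => i _. Qed.

(** [th] stays free because the theorem needs different values for [sigma2 > 0] and [sigma2 = 0]. *)
Lemma laplace_tail n N k (X : 'I_N -> T -> 'M[C]_n) (B : R)
    (S : 'I_N -> 'M[C]_n) (V : 'M[C]_(n, (n - k + 1)%N)) (mu sigma2 t th : R) :
  (forall j, random_mx (X j)) -> (forall j w, (X j w)^t* = X j w) ->
  independent_mx P X -> 0 < B -> (forall j, psdmx (S j)) ->
  (forall j, subexp_moments P B (S j) (X j)) ->
  (1 <= k <= n)%N -> V^t* *m V = 1%:M ->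
  mu = lambda_max (\sum_(j < N) V^t* *m expect_mx P (X j) *m V) ->
  sigma2 = lambda_max (\sum_(j < N) V^t* *m S j *m V) ->
  0 <= th -> th * B < 1 ->
  (P [set w | (mu + t <= lambda k (\sum_(j < N) X j w))%R] <=
   ((n - k + 1)%:R * expR (th ^+ 2 / (2 * (1 - th * B)) * sigma2 - th * t))%:E)%E.
Proof.
move=> mX hX indep B0 psdS mom kn hV emu esg th0 thB.
have iA j := mgf_integrable (mX j) (hX j) B0 (psdS j) (mom j) th0 thB.
have hM j := mgf_herm (mX j) (hX j) B0 (psdS j) (mom j) th0 thB.
have leM j := mgf_le (mX j) (hX j) B0 (psdS j) (mom j) th0 thB.
have gtM j := mgf_gt0 (mX j) (hX j) B0 (psdS j) (mom j) th0 thB.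
have hE j := expect_herm (hX j) (subexp_integrable1 (mX j) (hX j) (mom j)).
have hS j : (S j)^t* = S j by apply/hermP; case: (psdS j).
have /fin_all_exists[U /fin_all_exists[l hUl]] := fun j => mxlog (hM j) (gtM j).
have hU j : umx (U j) by have [] := hUl j.
have eM j : expect_mx P (fun w => mexp (th%:C *: X j w)) =
    spec (U j) (fun i => expR (l j i)) by have [] := hUl j.
have leL j : forall v, qform (spec (U j) (l j)) v <=
    qform (expect_mx P (fun w => mexp (th%:C *: X j w))) v - qform 1%:M v.
  by have [] := hUl j.
set g := th ^+ 2 / (2 * (1 - th * B)).
pose Y w := \sum_(j < N) X j w.
have hY w : (Y w)^t* = Y w by exact: herm_sum.
have bT (F : 'I_N -> 'M[C]_(n - k + 1)) :
    \sum_(j in [set: 'I_N]%SET) F j = \sum_(j < N) F j.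
  by apply: eq_bigl => j; rewrite finset.in_setT.
pose Z w := (0 : 'M[C]_(n - k + 1)) + \sum_(j in [set: 'I_N]%SET) V^t* *m (th%:C *: X j w) *m V.
have eZ w : V^t* *m (th%:C *: Y w) *m V = Z w.
  rewrite /Z add0r bT /Y scaler_sumr mulmx_sumr mulmx_suml.
  by apply: eq_bigr.
have hth w j : (th%:C *: X j w)^t* = th%:C *: X j w by exact: hthX.
have adj0 : (0 : 'M[C]_(n - k + 1))^t* = 0.
  by apply/matrixP => a b; rewrite adjmxE !mxE conjc0.
have hZ w : (Z w)^t* = Z w by apply: herm_sum_conj => // j; exact: hth.
have main : (\int[P]_w (trexp (Z w))%:E <=
    ((n - k + 1)%:R * expR (th * mu + g * sigma2))%:E)%E.
  apply: le_trans (expect_trexp_le mX hX indep hV iA hU eM [set: 'I_N]%SET adj0) _.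
  rewrite lee_fin; apply: trexp_le => [|v].
    by apply: herm_sum_conj => // j; exact: spec_herm.
  rewrite add0r bT qform_sum.
  (* Subtracting the identity in the bound on the logarithm cancels the constant term of
     [mgf_bound]. *)
  apply: (@le_trans _ _ (\sum_(j < N) (th * qform (expect_mx P (X j)) (V *m v)
      + g * qform (S j) (V *m v)))).
    apply: ler_sum => j _; rewrite qform_conj.
    apply: le_trans (leL j _) _; rewrite lerBlDl addrA; exact: leM.
  rewrite big_split /= -!mulr_sumr mulrDl -(mulrA th) -(mulrA g).
  have g0 : 0 <= g.
    by rewrite /g divr_ge0 ?sqr_ge0 // mulr_ge0 // subr_ge0 ltW.
  apply: lerD; apply: ler_wpM2l => //.
    rewrite emu; apply: le_trans (qform_le_lambda_max _ _).
      by rewrite qform_sum; apply: ler_sum => j _; rewrite qform_conj.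
    by apply: herm_sum => j; exact: herm_conj.
  rewrite esg; apply: le_trans (qform_le_lambda_max _ _).
    by rewrite qform_sum; apply: ler_sum => j _; rewrite qform_conj.
  by apply: herm_sum => j; exact: herm_conj.
have mY : random_mx Y by apply: random_mx_sum => j _; exact: mX.
pose E := [set w | (mu + t <= lambda k (Y w))%R].
have mE : measurable E by exact: measurable_lambda_ge.
have mZ : random_mx Z.
  apply: random_mxD; first exact: random_mx_cst.
  apply: random_mx_sum => j _; apply: random_mx_conj; exact: random_mxZ.
have mtZ : measurable_fun [set: T] (fun w => (trexp (Z w))%:E).
  by apply/measurable_EFinP; exact: measurable_trexp.
have markov : ((expR (th * (mu + t)))%:E * P E <= \int[P]_w (trexp (Z w))%:E)%E.
  rewrite -integral_cst //.
  apply: (@le_trans _ _ (\int[P]_(w in E) (trexp (Z w))%:E)%E).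
    apply: ge0_le_integral => //.
    - by move=> w _; rewrite lee_fin expR_ge0.
    - exact: measurable_funTS.
    - move=> w Ew; rewrite lee_fin -eZ; exact: lambda_compress.
  apply: ge0_subset_integral => //.
  by move=> w _; rewrite lee_fin trexp_ge0.
have PE : P E \is a fin_num by exact: fin_num_measure.
move: (le_trans markov main); rewrite -/E -(fineK PE) -EFinM !lee_fin.
move=> h; rewrite -(ler_pM2l (expR_gt0 (th * (mu + t)))).
apply: le_trans h _; rewrite mulrCA -expRD.
by rewrite le_eqVlt; apply/orP; left; apply/eqP; congr (_ * expR _); ring.
Qed.

End Tail.

Theorem theorem5p3 (R : realType) (d : measure_display) (T : measurableType d)
  (P : probability T R) (n N k : nat)
  (X : 'I_N -> T -> 'M[R[i]]_n) (B : R) (Sigma2 : 'I_N -> 'M[R[i]]_n)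
  (V : 'M[R[i]]_(n, (n - k + 1)%N)) (mu sigma2 : R)
  (X_random : forall j, random_mx (X j))
  (X_selfadjoint : forall j w, X j w \is hermsymmx)
  (X_indep : independent_mx P X)
  (B_gt0 : 0 < B)
  (Sigma2_psd : forall j, psdmx (Sigma2 j))
  (X_moments : forall j, subexp_moments P B (Sigma2 j) (X j))
  (k_bounds : (1 <= k <= n)%N)
  (mu_def : mu = lambda k (\sum_(j < N) expect_mx P (X j)))
  (V_stiefel : stiefel V)
  (V_mu : mu = lambda_max (\sum_(j < N) V ^t* *m expect_mx P (X j) *m V))
  (sigma2_def : sigma2 = lambda_max (\sum_(j < N) V ^t* *m Sigma2 j *m V))
  (t : R) (t_ge0 : 0 <= t) :
  let bound := (n - k + 1)%:R * expR (- ((t ^+ 2 / 2) / (sigma2 + B * t))) in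
  [/\ (P [set w | (mu + t <= lambda k (\sum_(j < N) X j w))%R] <= bound%:E)%E,
      t <= sigma2 / B ->
        bound <= (n - k + 1)%:R * expR (- (1 / 4 * (t ^+ 2 / sigma2))) &
      sigma2 / B <= t ->
        bound <= (n - k + 1)%:R * expR (- (1 / 4 * (t / B)))].
Proof.
move=> bound.
have hX j w : (X j w)^t* = X j w by apply/hermP; exact: X_selfadjoint.
have q1 : 1 <= (n - k + 1)%:R :> R by rewrite ler1n addn1.
have hS j : (Sigma2 j)^t* = Sigma2 j by apply/hermP; case: (Sigma2_psd j).
have s0 : 0 <= sigma2.
  have q0 : (0 < n - k + 1)%N by rewrite addn1.
  pose v : 'cV[R[i]]_(n - k + 1) := delta_mx (Ordinal q0) 0.
  have v0 : v != 0.
    apply/eqP => /matrixP/(_ (Ordinal q0) 0); rewrite !mxE !eqxx => /eqP.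
    by rewrite oner_eq0.
  have hQ : (\sum_(j < N) V^t* *m Sigma2 j *m V)^t* = \sum_(j < N) V^t* *m Sigma2 j *m V.
    by apply: herm_sum => j; exact: herm_conj.
  have := qform_le_lambda_max v hQ; rewrite -sigma2_def => h.
  rewrite -(pmulr_lge0 _ (qform1_gt0 v0)); apply: le_trans h.
  by rewrite qform_sum sumr_ge0 // => j _; rewrite qform_conj; exact: psdmx_qform.
have tail := laplace_tail t X_random hX X_indep B_gt0 Sigma2_psd X_moments
  k_bounds V_stiefel V_mu sigma2_def.
(* For [t = 0] every exponential equals [1] and the bounds are at least [1]; this covers the
   quotient [0 / 0], read as [0]. *)
have [t0|t_neq0] := eqVneq t 0.
  have b1 : bound = (n - k + 1)%:R.
    by rewrite /bound t0 expr0n !mul0r oppr0 expR0 mulr1.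
  have mE : measurable [set w | (mu + t <= lambda k (\sum_(j < N) X j w))%R].
    apply: measurable_lambda_ge => // [|w]; last exact: herm_sum.
    by apply: random_mx_sum => j _; exact: X_random.
  split.
  - rewrite b1; apply: le_trans (probability_le1 _ mE) _.
    by rewrite lee_fin.
  - by move=> _; rewrite b1 t0 expr0n mul0r mulr0 oppr0 expR0 mulr1.
  - by move=> _; rewrite b1 t0 mul0r mulr0 oppr0 expR0 mulr1.
have t_gt0 : 0 < t by rewrite lt_neqAle eq_sym t_neq0.
have Bt0 : 0 < B * t by exact: mulr_gt0.
have sBt0 : 0 < sigma2 + B * t by exact: ltr_wpDl.
split.
(* When [sigma2 = 0] the usual parameter would be [1 / B], excluded by [th * B < 1]; half of it
   already gives the exponent [- t / (2 B)]. *)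
- have [s_eq0|s_neq0] := eqVneq sigma2 0.
    have th0 : 0 <= (2 * B)^-1 by rewrite invr_ge0; apply: mulr_ge0; [|exact: ltW].
    have thB : (2 * B)^-1 * B = 2^-1 by field; rewrite gt_eqF.
    have half1 : (2^-1 : R) < 1 by rewrite invf_lt1 // ltr1n.
    have := tail _ th0; rewrite thB => /(_ half1).
    rewrite s_eq0 mulr0 sub0r => h; apply: le_trans h _.
    rewrite lee_fin /bound s_eq0 add0r ler_wpM2l // ler_expR lerN2.
    rewrite le_eqVlt; apply/orP; left; apply/eqP; field.
    by rewrite !gt_eqF.
  have s_gt0 : 0 < sigma2 by rewrite lt_neqAle eq_sym s_neq0.
  have th0 : 0 <= t / (sigma2 + B * t) by apply: divr_ge0; exact: ltW.
  have e1 : 1 - t / (sigma2 + B * t) * B = sigma2 / (sigma2 + B * t).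
    by field; rewrite gt_eqF.
  have lt1 : t / (sigma2 + B * t) * B < 1.
    by rewrite -subr_gt0 e1 divr_gt0.
  apply: le_trans (tail _ th0 lt1) _; rewrite e1.
  rewrite lee_fin /bound ler_wpM2l // ler_expR.
  rewrite le_eqVlt; apply/orP; left; apply/eqP; field.
  by rewrite !gt_eqF.
(* Here [B t <= sigma2], so the denominator is at most [2 sigma2], whence the constant [1 / 4];
   [t > 0] forces [sigma2 > 0]. *)
- rewrite ler_pdivlMr // => ts; rewrite /bound ler_wpM2l // ler_expR lerN2.
  have s_gt0 : 0 < sigma2 by apply: lt_le_trans ts; exact: mulr_gt0.
  rewrite -subr_ge0.
  have -> : t ^+ 2 / 2 / (sigma2 + B * t) - 1 / 4 * (t ^+ 2 / sigma2) =
      t ^+ 2 * (sigma2 - t * B) / (4 * sigma2 * (sigma2 + B * t)).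
    by field; rewrite !gt_eqF.
  apply: divr_ge0; first by rewrite mulr_ge0 ?sqr_ge0 // subr_ge0.
  by apply: mulr_ge0; [apply: mulr_ge0 => //|apply: ltW].
(* Here the denominator is at most [2 B t]. *)
- rewrite ler_pdivrMr // => ts; rewrite /bound ler_wpM2l // ler_expR lerN2.
  rewrite -subr_ge0.
  have -> : t ^+ 2 / 2 / (sigma2 + B * t) - 1 / 4 * (t / B) =
      t * (t * B - sigma2) / (4 * B * (sigma2 + B * t)).
    by field; rewrite !gt_eqF.
  apply: divr_ge0; first by rewrite mulr_ge0 // subr_ge0.
  by apply: mulr_ge0; [apply: mulr_ge0 => //; exact: ltW|apply: ltW].
Qed.
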